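(* Let $\{w^k\}=\{(u^k,p^k)\}$ be the random sequence generated by the RPDC method for problem (P) (both as defined in the context), under the assumptions on (P), $K$, $\epsilon$, $\rho$ listed in the context. Then: (i) $\sum_{k=0}^{+\infty}\|w^k-T(w^k)\|^2<+\infty$ almost surely; (ii) the sequence $\{w^k\}$ generated by RPDC is almost surely bounded; (iii) every cluster point of $\{w^k\}$ almost surely is a saddle point of the Lagrangian $L$ of (P).
   Context: Problem (P): minimize $F(u)=G(u)+J(u)$ subject to $Au-b=0$, $u\in\mathbf{U}$, where $\mathbf{U}=\mathbf{U}_1\times\cdots\times\mathbf{U}_N\subset\mathbb{R}^n$ is closed and convex, $\mathbf{U}_i\subset\mathbb{R}^{n_i}$, $\sum_i n_i=n$; $A=(A_1,\dots,A_N)\in\mathbb{R}^{m\times n}$ with $A_i\in\mathbb{R}^{m\times n_i}$, $b\in\mathbb{R}^m$; $J(u)=\sum_{i=1}^N J_i(u_i)$ with each $J_i$ a convex, possibly non-smooth function on $\mathbf{U}_i$. Assumptions on (P): $J$ is a convex, lower semi-continuous function (not necessarily differentiable) such that $\mathbf{dom}\,J\cap\mathbf{U}\neq\emptyset$; $G$ is convex and differentiable and its derivative is Lipschitz with constant $B_G$; the Lagrangian $L(u,p)=F(u)+\langle p,Au-b\rangle$ has at least one saddle point, i.e. a point $(u^*,p^* )\in\mathbf{U}\times\mathbb{R}^m$ with $L(u^*,p)\le L(u^*,p^* )\le L(u,p^* )$ for all $u\in\mathbf{U}$, $p\in\mathbb{R}^m$. Core function and parameters: $K$ is strongly convex with parameter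 $\beta$ and differentiable, with gradient Lipschitz continuous with parameter $B$ on $\mathbf{U}$; $D(u,v)=K(u)-K(v)-\langle\nabla K(v),u-v\rangle$. The parameters $\gamma$, $\epsilon$, $\rho$ satisfy $0<\epsilon<\beta/[B_G+\gamma\lambda_{\max}(A^\top A)]$ and $0<\rho<\frac{2\gamma}{2N-1}$ (so $\gamma>0$), with $\lambda_{\max}(A^\top A)$ the largest eigenvalue of $A^\top A$. RPDC method: from an initial point $u^0\in\mathbf{U}$, $p^0\in\mathbb{R}^m$, for $k=0,1,2,\dots$: choose $i(k)$ from $\{1,\dots,N\}$ with equal probability; with $q^k=p^k+\gamma(Au^k-b)$ set $$u^{k+1}=\arg\min_{u\in\mathbf{U}}\ \langle\nabla_{i(k)}G(u^k),u_{i(k)}\rangle+J_{i(k)}(u_{i(k)})+\langle q^k,A_{i(k)}u_{i(k)}\rangle+\tfrac1\epsilon D(u,u^k),\qquad p^{k+1}=p^k+\rho(Au^{k+1}-b),$$ and $w^k=(u^k,p^k)$. Reference point: for given $w^k=(u^k,p^k)$, $T(w^k)=(T_u(w^k),T_p(w^k))$, where $T_u(w^k)=\arg\min_{u\in\mathbf{U}}\langle\nabla G(u^k),u\rangle+J(u)+\langle q^k,Au\rangle+\frac1\epsilon D(u,u^k)$ and $T_p(w^k)=p^k+\gamma[AT_u(w^k)-b]$.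
   Formalization: The core function K is additionally assumed additive over the blocks on U, K(u)=ΣK_i(u_i), so each step changes only block i(k); for a K coupling blocks the iteration can diverge almost surely and (ii) fails. *)

(* Defs.v *)
From HB Require Import structures.
From mathcomp Require Export all_boot all_order all_algebra.
From mathcomp Require Export all_classical all_reals all_analysis.

Set Implicit Arguments.
Unset Strict Implicit.
Unset Printing Implicit Defensive.

Import Order.TTheory GRing.Theory Num.Theory.
Import numFieldNormedType.Exports.

Local Open Scope classical_set_scope.
Local Open Scope ring_scope.

(* The library norm on matrices is the sup norm; every quantitative notion
   below (Lipschitz constants, strong convexity, the distance ||w - T w||) uses
   the Euclidean structure instead.  Topological notions (closed, lower
   semicontinuous, differentiable, cluster, bounded) do not depend on this. *)
Section Euclidean.
Context {R : realType} {n : nat}.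
Implicit Types (u v : 'cV[R]_n) (C : set 'cV[R]_n).

Definition dotv u v : R := \sum_i u i 0 * v i 0.

Definition enorm u : R := Num.sqrt (dotv u u).

Definition grad (f : 'cV[R]_n -> R) u : 'cV[R]_n :=
  \col_j 'D_(delta_mx j 0) f u.

Definition elipschitz C (M : R) (g : 'cV[R]_n -> 'cV[R]_n) :=
  forall u v, C u -> C v -> enorm (g u - g v) <= M * enorm (u - v).

Definition strongly_convex C (beta : R) (f : 'cV[R]_n -> R) :=
  0 < beta /\
  forall u v (t : R), C u -> C v -> 0 <= t <= 1 ->
    f (t *: u + (1 - t) *: v) <=
      t * f u + (1 - t) * f v - beta / 2 * t * (1 - t) * enorm (u - v) ^+ 2.

(* Extended-valued counterpart of the library's convex_function; 0 * +oo = 0,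
   so the cases t = 0 and t = 1 are trivial even at points where f = +oo. *)
Definition convex_efunction C (f : 'cV[R]_n -> \bar R) :=
  forall u v (t : R), C u -> C v -> 0 <= t <= 1 ->
    (f (t *: u + (1 - t) *: v)%R <= t%:E * f u + (1 - t)%:E * f v)%E.

Definition bregman (K : 'cV[R]_n -> R) u v : R :=
  K u - K v - dotv (grad K v) (u - v).

Definition minimizers C (f : 'cV[R]_n -> \bar R) : set 'cV[R]_n :=
  [set u | C u /\ forall v, C v -> (f u <= f v)%E].

(* The default value 0 is only taken when there is no minimizer. *)
Definition argmin C (f : 'cV[R]_n -> \bar R) : 'cV[R]_n :=
  xget 0 (minimizers C f).

End Euclidean.

(* For n = 0 there is no eigenvalue and the value is sup set0 = 0. *)
Definition lambda_max {R : realType} {n : nat} (M : 'M[R]_n) : R :=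
  sup [set a | eigenvalue M a].

Definition saddle_point {R : realType} {V W : Type} (C : set V)
    (L : V -> W -> \bar R) (w : V * W) :=
  [/\ C w.1,
      forall p, (L w.1 p <= L w.1 w.2)%E &
      forall u, C u -> (L w.1 w.2 <= L u w.2)%E].

Definition mutually_independent {d} {T : measurableType d} {R : realType}
    (P : probability T R) {I : Type} (X : nat -> T -> I) :=
  forall (s : seq nat) (B : nat -> set I), uniq s ->
    (P (\bigcap_(k in [set` s]) (X k @^-1` B k)) =
     \prod_(k <- s) P (X k @^-1` B k))%E.

Definition iid_uniform {d} {T : measurableType d} {R : realType}
    (P : probability T R) {N : nat} (idx : nat -> T -> 'I_N) :=
  [/\ forall k i, measurable (idx k @^-1` [set i]),
      forall k i, P (idx k @^-1` [set i]) = (N%:R^-1)%:E &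
      mutually_independent P idx].

(* A vector of R^n, with n = n_1 + ... + n_N, is a column of size
   \sum_i dim i; its i-th block is submxcol u i, and the i-th column block of
   the matrix A is submxrow A i. *)
Section Problem.
Context {R : realType} {N m : nat} {dim : 'I_N -> nat}.
Local Notation n := (\sum_i dim i)%N.
Context (A : 'M[R]_(m, n)) (b : 'cV[R]_m).
Context (Ub : forall i, set 'cV[R]_(dim i)).
Context (G : 'cV[R]_n -> R) (Jb : forall i, 'cV[R]_(dim i) -> \bar R).
Implicit Types (u v : 'cV[R]_n) (p : 'cV[R]_m) (w : 'cV[R]_n * 'cV[R]_m).

Definition prod_blocks : set 'cV[R]_n :=
  [set u | forall i, Ub (submxcol u i)].

Definition sum_blocks u : \bar R := (\sum_i Jb (submxcol u i))%E.

Definition objective u : \bar R := ((G u)%:E + sum_blocks u)%E.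

Definition lagrangian u p : \bar R :=
  (objective u + (dotv p (A *m u - b)%R)%:E)%E.

(* Additivity of the core function K along the blocks.  It makes the i-th
   subproblem of rpdc_step a coordinate update: blocks other than i keep their
   value.  For a K that couples blocks the iteration may diverge almost
   surely. *)
Definition block_separable (C : set 'cV[R]_n) (K : 'cV[R]_n -> R) :=
  exists Kb : forall i, 'cV[R]_(dim i) -> R,
    forall u, C u -> K u = \sum_i Kb i (submxcol u i).

Context (K : 'cV[R]_n -> R) (gamma eps rho : R).

Definition qmult w : 'cV[R]_m := w.2 + gamma *: (A *m w.1 - b).

Definition rpdc_subobj (i : 'I_N) w u : \bar R :=
  ((dotv (submxcol (grad G w.1) i) (submxcol u i))%:E
   + Jb (submxcol u i)
   + (dotv (qmult w) (submxrow A i *m submxcol u i)%R)%:E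
   + (eps^-1 * bregman K u w.1)%:E)%E.

Definition rpdc_step (i : 'I_N) w : 'cV[R]_n * 'cV[R]_m :=
  let u' := argmin prod_blocks (rpdc_subobj i w) in
  (u', w.2 + rho *: (A *m u' - b)).

Fixpoint rpdc (w0 : 'cV[R]_n * 'cV[R]_m) (i : nat -> 'I_N) (k : nat) :=
  if k is k'.+1 then rpdc_step (i k') (rpdc w0 i k') else w0.

Definition ref_subobj w u : \bar R :=
  ((dotv (grad G w.1) u)%:E
   + sum_blocks u
   + (dotv (qmult w) (A *m u)%R)%:E
   + (eps^-1 * bregman K u w.1)%:E)%E.

Definition ref_point w : 'cV[R]_n * 'cV[R]_m :=
  let Tu := argmin prod_blocks (ref_subobj w) in
  (Tu, w.2 + gamma *: (A *m Tu - b)).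

End Problem.

(* ||w|| for w = (u, p) is the Euclidean norm of the stacked vector. *)
Definition pair_norm {R : realType} {n m : nat}
    (w : 'cV[R]_n * 'cV[R]_m) : R := enorm (col_mx w.1 w.2).

(* Main.v *)
Require Import Defs.
From mathcomp Require Import all_boot all_order all_algebra.
From mathcomp Require Import all_classical all_reals all_analysis.
From mathcomp Require Import ring lra.
Import Order.TTheory GRing.Theory Num.Theory.
Import numFieldNormedType.Exports.
Local Open Scope classical_set_scope.
Local Open Scope ring_scope.

(* Fix a saddle point (u*, p* ) and write r(u) = A u - b.  Along the iteration
     V(u, p) = (N / eps) D(u*, u) + |p - p*|^2 / (2 rho)
       + (N - 1) (F(u) + <p, r(u)> + gamma/2 |r(u)|^2 - F(u* )) - gamma/2 |r(u)|^2
   is nonnegative and controls |u - u*|^2 + |p - p*|^2.  As K is separable, the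
   step for index i replaces only block i of u, by that of the reference point
   T_u(w); summing over i therefore turns block increments into increments along
   T_u(w) - u, and the variational inequality for T_u(w) gives
     E[V(w+) | w] <= V(w) - c |T_u(w) - u|^2 - c' E[|r(u+)|^2 | w],
   whose decrement dominates |w - T(w)|^2.  V plus the accumulated decrements is
   thus a nonnegative supermartingale, bounded almost surely by Ville's maximal
   inequality; this yields (i) and (ii), and (iii) follows by passing to the limit
   in the variational inequality.  When J(u0) is infinite, V is finite only after
   every block has been drawn, which happens at an almost surely finite time. *)

Set Implicit Arguments.
Unset Strict Implicit.
Unset Printing Implicit Defensive.

(** The coefficients of V come from one cancellation; write xs, ps for the saddle point. Expanding
    the squared distance of the new multiplier to ps produces <p - ps, r(u+)>, which the saddle
    inequality at u+ bounds by F(u+) - F(xs) + <p, r(u+)>. This extra copy raises N - 1 to N, and N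
    cancels the probability 1/N of each block. What is left over at w is F(u) - F(xs) + <p, r(u)> +
    gamma |r(u)|^2, with gamma instead of gamma/2 because of the last term of V. The variational
    inequality at xs removes exactly this, since q = p + gamma r(u). The bounds on eps and rho say
    that the two coefficients that survive, [primal_rate] and [dual_rate], are positive. The
    obstacle is that the augmented gap in V has no sign when p differs from ps; its negative part is
    absorbed by |p - ps|^2 / (2 rho), again through the bound on rho. Conditioning takes place on
    the tree of finite draw sequences: a node of length k has probability N^-k, and a conditional
    mean is an average over N children. Once the potential is bounded along a path, the rest is
    deterministic. *)

(** * Euclidean inner product and norm on column vectors *)

Section EuclideanSpace.
Context {R : realType} {n : nat}.
Implicit Types u v x y z : 'cV[R]_n.

Lemma dotvE u v : dotv u v = (u^T *m v) 0 0.
Proof. by rewrite mxE; apply: eq_bigr => i _; rewrite mxE. Qed.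

Lemma dotvC u v : dotv u v = dotv v u.
Proof. by apply: eq_bigr => i _; rewrite mulrC. Qed.

Lemma dotvDl x y z : dotv (x + y) z = dotv x z + dotv y z.
Proof. by rewrite !dotvE linearD mulmxDl mxE. Qed.

Lemma dotvDr x y z : dotv x (y + z) = dotv x y + dotv x z.
Proof. by rewrite !dotvE mulmxDr mxE. Qed.

Lemma dotvNl x y : dotv (- x) y = - dotv x y.
Proof. by rewrite !dotvE linearN mulNmx mxE. Qed.

Lemma dotvNr x y : dotv x (- y) = - dotv x y.
Proof. by rewrite !dotvE mulmxN mxE. Qed.

Lemma dotvZl a x y : dotv (a *: x) y = a * dotv x y.
Proof. by rewrite !dotvE linearZ -scalemxAl mxE. Qed.

Lemma dotvZr a x y : dotv x (a *: y) = a * dotv x y.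
Proof. by rewrite !dotvE -scalemxAr mxE. Qed.

Lemma dotv0l x : dotv 0 x = 0.
Proof. by rewrite -(scale0r 0) dotvZl mul0r. Qed.

Lemma dotv0r x : dotv x 0 = 0.
Proof. by rewrite dotvC dotv0l. Qed.

Definition dotv_lin := (dotvDl, dotvDr, dotvNl, dotvNr, dotvZl, dotvZr).

Lemma dotv_sqrD a x y :
  dotv (x + a *: y) (x + a *: y) = dotv x x + 2 * a * dotv x y + a ^+ 2 * dotv y y.
Proof. by rewrite !dotv_lin (dotvC y x); ring. Qed.

Lemma dotvv_ge0 x : 0 <= dotv x x.
Proof. by apply: sumr_ge0 => i _; rewrite -expr2 sqr_ge0. Qed.

Lemma dotvv_eq0 x : (dotv x x == 0) = (x == 0).
Proof.
apply/eqP/eqP => [x0|->]; last by rewrite dotv0l.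
apply/colP => i; rewrite mxE; apply/eqP; rewrite -sqrf_eq0 expr2; apply/eqP.
by move: i isT; apply/psumr_eq0P => // i _; rewrite -expr2 sqr_ge0.
Qed.

Lemma enorm_ge0 x : 0 <= enorm x. Proof. exact: sqrtr_ge0. Qed.

Lemma sqr_enorm x : enorm x ^+ 2 = dotv x x.
Proof. by rewrite sqr_sqrtr // dotvv_ge0. Qed.

Lemma enormN x : enorm (- x) = enorm x.
Proof. by rewrite /enorm dotvNl dotvNr opprK. Qed.

Lemma enormZ a x : enorm (a *: x) = `|a| * enorm x.
Proof.
by rewrite /enorm dotvZl dotvZr mulrA -expr2 sqrtrM ?sqr_ge0 // sqrtr_sqr.
Qed.

Lemma enorm_eq0 x : (enorm x == 0) = (x == 0).
Proof. by rewrite -dotvv_eq0 -sqr_enorm sqrf_eq0. Qed.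

Lemma enorm0 : enorm (0 : 'cV[R]_n) = 0.
Proof. by apply/eqP; rewrite enorm_eq0. Qed.

Lemma dotv_young a x y : 0 < a -> 2 * dotv x y <= a * dotv x x + a^-1 * dotv y y.
Proof.
move=> a0; rewrite -(ler_pM2l a0) -subr_ge0.
have := dotvv_ge0 (a *: x - y); rewrite !dotv_lin (dotvC y x).
by rewrite mulrDr (mulrA a a^-1) divff ?gt_eqF // mul1r; nra.
Qed.

(** Cauchy-Schwarz, from [dotv_young] at the optimal weight [enorm y / enorm x], for which its right
    side is [2 * (enorm x * enorm y)]. *)
Lemma dotv_le x y : dotv x y <= enorm x * enorm y.
Proof.
have [/eqP|x0] := eqVneq (enorm x) 0.
  by rewrite enorm_eq0 => /eqP->; rewrite dotv0l enorm0 mul0r.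
have [/eqP|y0] := eqVneq (enorm y) 0.
  by rewrite enorm_eq0 => /eqP->; rewrite dotv0r enorm0 mulr0.
have {}x0 : 0 < enorm x by rewrite lt_neqAle eq_sym x0 enorm_ge0.
have {}y0 : 0 < enorm y by rewrite lt_neqAle eq_sym y0 enorm_ge0.
rewrite -(ler_pM2l (ltr0n R 2)).
apply: (le_trans (dotv_young _ _ (divr_gt0 y0 x0))).
rewrite -!sqr_enorm le_eqVlt; apply/orP; left; apply/eqP; field.
by rewrite !gt_eqF.
Qed.

Lemma ler_enormD x y : enorm (x + y) <= enorm x + enorm y.
Proof.
rewrite -(@ler_pXn2r _ 2) ?nnegrE ?addr_ge0 ?enorm_ge0 //.
rewrite sqr_enorm !dotv_lin (dotvC y x) sqrrD !sqr_enorm.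
by have := dotv_le x y; rewrite mulr2n; lra.
Qed.

Lemma normr_coord_le x : `|x| <= enorm x.
Proof.
rewrite [`|x|]/Num.norm /= mx_normrE; apply/bigmax_leP; split; first exact: enorm_ge0.
move=> [i j] _ /=; rewrite (ord1 j) -sqrtr_sqr ler_wsqrtr //.
rewrite /dotv (bigD1 i) //= expr2 lerDl sumr_ge0 // => k _.
by rewrite -expr2 sqr_ge0.
Qed.

Lemma normr_entry_le x i : `|x i 0| <= `|x|.
Proof.
rewrite [leRHS]/Num.norm /= mx_normrE.
exact: (@le_bigmax _ _ _ 0 (fun k : 'I_n * 'I_1 => `|x k.1 k.2|) (i, 0)).
Qed.

Lemma continuous_entry {T : topologicalType} (f : T -> 'cV[R]_n) (F : set_system T)
  {FF : Filter F} x i : f @ F --> x -> (fun t => f t i 0) @ F --> x i 0.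
Proof.
move=> fx; apply: (@cvg_comp _ _ _ f (fun z => z i 0) _ _ _ fx).
exact: (@coord_continuous R n 1 i 0).
Qed.

Lemma cvg_dotv {T : topologicalType} (f g : T -> 'cV[R]_n) (F : set_system T)
    {FF : Filter F} x y :
  f @ F --> x -> g @ F --> y -> (fun t => dotv (f t) (g t)) @ F --> dotv x y.
Proof.
move=> fx gy; apply: cvg_big => [|i _]; first exact: add_continuous.
by apply: cvgM; exact: continuous_entry.
Qed.

Lemma cvg_enorm {T : topologicalType} (f : T -> 'cV[R]_n) (F : set_system T)
    {FF : Filter F} x : f @ F --> x -> (fun t => enorm (f t)) @ F --> enorm x.
Proof.
move=> fx; apply: (@cvg_comp _ _ _ _ Num.sqrt _ _ _ (cvg_dotv fx fx)).
exact: sqrt_continuous.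
Qed.

Lemma cvg_enorm0 {T : topologicalType} (f : T -> 'cV[R]_n) (F : set_system T)
    {FF : Filter F} : (fun t => enorm (f t)) @ F --> (0 : R) -> f @ F --> (0 : 'cV[R]_n).
Proof.
move=> f0; apply/cvgr0Pnorm_lt => e e0.
move/cvgr0Pnorm_lt: f0 => /(_ e e0); apply: filterS => t.
by rewrite ger0_norm ?enorm_ge0 //; apply: le_lt_trans; exact: normr_coord_le.
Qed.

Lemma compact_eball (C : set 'cV[R]_n) x r :
  closed C -> compact (C `&` [set y | enorm (y - x) <= r]).
Proof.
move=> cC; set S := _ `&` _.
have cS : closed S.
  have cf : {in ~` (fun y => enorm (y - x)) @^-1` [set t | t <= r],
             continuous (fun y => enorm (y - x))}.
    move=> y _; apply: (@cvg_enorm _ (fun y : 'cV[R]_n => y - x) (nbhs y) _).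
    by apply: cvgB; [exact: cvg_id|exact: cvg_cst].
  exact: (closedI cC (preimage_closed cf (@closed_le _ r))).
(* [bounded_closed_compact] is about row vectors; compactness is carried over to columns by the
   continuity of transposition. *)
have ctr k l : continuous (@trmx R k l : 'M[R]_(k, l) -> 'M[R]_(l, k)).
  move=> A B /nbhs_ballP[e /= e0 eB]; apply/nbhs_ballP; exists e => //= D AD.
  by apply: eB; split=> // i j; case: AD => _ AD; rewrite !mxE; exact: AD.
have -> : S = trmx @` [set z : 'rV[R]_n | S z^T].
  apply/seteqP; split => [y Sy|_ [z Sz <-] //].
  by exists y^T => /=; rewrite trmxK.
apply: continuous_compact; first by apply: continuous_subspaceT; exact: ctr.
apply: bounded_closed_compact; last first.
  have := @continuous_closedP _ _ (@trmx R 1 n : 'rV[R]_n -> 'cV[R]_n).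
  by case=> /(_ (ctr 1 n) S cS).
exists (r + enorm x); split; first exact: num_real.
move=> M hM z [_ /= zr]; apply: le_trans (ltW hM).
rewrite [`|z|]/Num.norm /= mx_normrE; apply/bigmax_leP; split.
  by rewrite addr_ge0 ?enorm_ge0 //; apply: le_trans zr; exact: enorm_ge0.
move=> [i j] _ /=; rewrite (ord1 i).
have -> : z 0 j = z^T j 0 by rewrite mxE.
apply: le_trans (normr_entry_le _ _) _; apply: le_trans (normr_coord_le _) _.
by rewrite -{1}(subrK x z^T); apply: le_trans (ler_enormD _ _) _; rewrite lerD2r.
Qed.

End EuclideanSpace.

Lemma ler_limits {R : realType} {T : Type} (F : set_system T) {FF : ProperFilter F}
    (f g : T -> R) (a b : R) :
  f @ F --> a -> g @ F --> b -> (\forall t \near F, f t <= g t) -> a <= b.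
Proof.
move=> fa gb fg; rewrite -subr_ge0.
have gf : (fun t => g t - f t) @ F --> b - a by exact: cvgB.
by apply: (cvgr_to_ge gf); apply: filterS fg => t; rewrite subr_ge0.
Qed.

(** * First-order inequalities for convex functions *)

Section Gradient.
Context {R : realType} {n : nat}.
Implicit Types (u v : 'cV[R]_n) (f : 'cV[R]_n -> R) (C : set 'cV[R]_n).

Lemma dotv_gradE f u v : differentiable f u -> dotv (grad f u) v = 'D_v f u.
Proof.
move=> df; rewrite deriveE // [in RHS](matrix_sum_delta v) linear_sum.
apply: eq_bigr => i _; rewrite big_ord1 linearZ /= !mxE mulrC deriveE //.
Qed.

(** The limit is taken from the right because feasibility of [u + h *: v] will be known only for [h]
    between 0 and 1. *)
Lemma cvg_dirderiv f u v : differentiable f u ->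
  (fun h => h^-1 * (f (u + h *: v) - f u)) @ 0^'+ --> dotv (grad f u) v.
Proof.
move=> df; rewrite dotv_gradE //; apply: cvg_dnbhs_at_right.
have -> : (fun h => h^-1 * (f (u + h *: v) - f u)) =
    (fun h => h^-1 *: ((f \o shift u) (h *: v) - f u)).
  by apply/funext => h /=; rewrite (addrC u).
exact: (@diff_derivable R _ _ f u v df).
Qed.

(** The slack [t * c] accommodates a second-order remainder, such as the one of strong convexity; it
    disappears in the limit. *)
Lemma grad_dir_le f u v (a c : R) : differentiable f u ->
  (forall t, 0 < t <= 1 -> f (u + t *: v) - f u <= t * (a + t * c)) ->
  dotv (grad f u) v <= a.
Proof.
move=> df fle.
have ca : (fun t : R => a + t * c) @ 0^'+ --> a.
  rewrite -[X in _ --> X]addr0 -[X in _ --> _ + X](mul0r c).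
  by apply: cvg_at_right_filter; apply: cvgD; [exact: cvg_cst|];
    apply: cvgM; [exact: cvg_id|exact: cvg_cst].
apply: (@ler_limits R R (0^'+) _ _ _ _ _ (cvg_dirderiv (v := v) df) ca).
near=> t.
have t0 : 0 < t by [].
rewrite ler_pdivrMl //; apply: fle; rewrite t0 /=.
near: t; exact: nbhs_right_le.
Unshelve. all: by end_near. Qed.

Lemma grad_dir_ge f u v (a : R) : differentiable f u ->
  (forall t, 0 < t <= 1 -> t * a <= f (u + t *: v) - f u) ->
  a <= dotv (grad f u) v.
Proof.
move=> df fge.
apply: (@ler_limits R R (0^'+) _ _ _ _ _ (@cvg_cst _ a _ (0^'+) _) (cvg_dirderiv (v := v) df)).
near=> t.
have t0 : 0 < t by [].
rewrite ler_pdivlMl //; apply: fge; rewrite t0 /=.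
near: t; exact: nbhs_right_le.
Unshelve. all: by end_near. Qed.

Lemma convex_setP C : convex_set C -> forall u v (t : R), C u -> C v ->
  0 <= t <= 1 -> C (t *: u + (1 - t) *: v).
Proof.
move=> cC u v t Cu Cv /andP[t0 t1].
have := cC u v (Itv01 t0 t1) (mem_set Cu) (mem_set Cv).
by rewrite inE.
Qed.

Lemma convex_functionP C f : convex_function C f -> forall u v (t : R),
  C u -> C v -> 0 <= t <= 1 ->
  f (t *: u + (1 - t) *: v) <= t * f u + (1 - t) * f v.
Proof.
move=> cf u v t Cu Cv /andP[t0 t1].
exact: (cf (Itv01 t0 t1) u v (mem_set Cu) (mem_set Cv)).
Qed.

Lemma add_scale_subE u v (t : R) : u + t *: (v - u) = t *: v + (1 - t) *: u.
Proof. by rewrite scalerBr scalerBl scale1r addrCA. Qed.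

Lemma strongly_convex_grad C beta f u v : strongly_convex C beta f ->
  C u -> C v -> differentiable f u ->
  dotv (grad f u) (v - u) <= f v - f u - beta / 2 * enorm (v - u) ^+ 2.
Proof.
move=> [_ sc] Cu Cv df.
apply: (@grad_dir_le _ _ _ _ (beta / 2 * enorm (v - u) ^+ 2)) => // t.
case/andP=> t0 t1; rewrite add_scale_subE.
have := sc v u t Cv Cu; rewrite (ltW t0) t1 => /(_ isT).
lra.
Qed.

Lemma convex_grad f u v : convex_function setT f -> differentiable f u ->
  dotv (grad f u) (v - u) <= f v - f u.
Proof.
move=> cf df; apply: (@grad_dir_le _ _ _ _ 0) => // t /andP[t0 t1].
rewrite add_scale_subE; have := convex_functionP cf (u := v) (v := u) (t := t) I I.
rewrite (ltW t0) t1 => /(_ isT); lra.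
Qed.

Lemma bregman_ge C beta f u v : strongly_convex C beta f ->
  C u -> C v -> differentiable f v ->
  beta / 2 * enorm (u - v) ^+ 2 <= bregman f u v.
Proof.
move=> sc Cu Cv df; have := strongly_convex_grad sc Cv Cu df.
by rewrite /bregman; lra.
Qed.

(* The convexity inequality at the intermediate points u + (k/N) h bounds each
   increment by the slope at its right end; the sum is a Riemann sum. *)
Lemma descent_lemma BG f u v : convex_function setT f ->
  (forall x, differentiable f x) -> elipschitz setT BG (grad f) ->
  f v <= f u + dotv (grad f u) (v - u) + BG / 2 * enorm (v - u) ^+ 2.
Proof.
move=> cf df lf; set h := v - u; set g := dotv _ h; set e := enorm h ^+ 2.
have slope s : 0 <= s -> dotv (grad f (u + s *: h)) h <= g + s * (BG * e).
  move=> s0; rewrite -lerBlDl -dotvNl -dotvDl.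
  apply: le_trans (dotv_le _ _) _.
  apply: le_trans (ler_wpM2r (enorm_ge0 _) (lf _ _ I I)) _.
  rewrite addrAC subrr add0r enormZ ger0_norm // /e expr2.
  by rewrite le_eqVlt; apply/orP; left; apply/eqP; ring.
(* The last term is [BG * e / N.+1%:R ^+ 2] times the sum of the integers up to [k]; at [k = N.+1]
   it tends to [BG * e / 2]. *)
have riemann N k : f (u + (k%:R / N.+1%:R) *: h) <= f u + k%:R / N.+1%:R * g
    + BG * e * (k%:R * (k%:R + 1)) / 2 / N.+1%:R ^+ 2.
  have N0 : N.+1%:R != 0 :> R by rewrite pnatr_eq0.
  elim: k => [|k IH].
    by rewrite !mul0r scale0r addr0 mulr0 !mul0r !addr0.
  set x := u + (k%:R / N.+1%:R) *: h in IH; set y := u + (k.+1%:R / N.+1%:R) *: h.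
  have yx : x - y = - N.+1%:R^-1 *: h.
    rewrite /x /y opprD addrACA subrr add0r -scalerBl; congr (_ *: _).
    by rewrite -mulrBl -natr1 opprD addrA subrr sub0r mulN1r.
  have := convex_grad x cf (df y); rewrite yx dotvZr.
  have := slope (k.+1%:R / N.+1%:R) (divr_ge0 (ler0n _ _) (ler0n _ _)).
  rewrite -/y => sl cg.
  have {}cg : f y <= f x + N.+1%:R^-1 * dotv (grad f y) h.
    by move: cg; rewrite mulNr lerBrDr addrC lerBlDr.
  apply: le_trans cg _; apply: le_trans (lerD IH (ler_wpM2l _ sl)) _.
    by rewrite invr_ge0.
  rewrite le_eqVlt; apply/orP; left; apply/eqP; rewrite -(natr1 k).
  by field; rewrite ?(addrC 1) ?(natr1 N) ?pnatr_eq0.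
have lim_ub : (fun N : nat => f u + g + BG * e / 2 + BG * e / 2 * N.+1%:R^-1) @ \oo
    --> f u + g + BG * e / 2 + BG * e / 2 * 0.
  apply: cvgD; first exact: cvg_cst.
  by apply: cvgM; [exact: cvg_cst|exact: cvg_harmonic].
have -> : f u + g + BG / 2 * e = f u + g + BG * e / 2 + BG * e / 2 * 0 by ring.
apply: (@ler_limits R nat \oo _ _ _ _ _ (@cvg_cst _ (f v) nat \oo _) lim_ub).
apply: nearW => N /=; have := riemann N N.+1; rewrite divff ?pnatr_eq0 //.
rewrite scale1r [u + h]addrCA subrr addr0 => /le_trans; apply.
rewrite le_eqVlt; apply/orP; left; apply/eqP; field.
by rewrite ?(addrC 1) ?(natr1 N) ?pnatr_eq0.
Qed.

End Gradient.

(** * Existence and uniqueness of minimizers *)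

Section Minimizers.
Context {R : realType}.

Lemma lte_between (x y : \bar R) : (x < y)%E -> exists a : R, (x < a%:E < y)%E.
Proof.
case: x y => [r| |] [s| |] //.
- rewrite lte_fin => rs; exists ((r + s) / 2).
  by rewrite !lte_fin (midf_lt rs).1 (midf_lt rs).2.
- by exists (r + 1); rewrite lte_fin ltrDl ltr01 ltry.
- by exists (s - 1); rewrite lte_fin ltNyr gtrDl oppr_lt0 ltr01.
- by exists 0; rewrite ltNyr ltry.
Qed.

Definition lower_semicontinuous_on {X : topologicalType} (C : set X)
    (f : X -> \bar R) :=
  forall x (a : R), C x -> (a%:E < f x)%E ->
    exists2 V, nbhs x V & forall y, V y -> C y -> (a%:E < f y)%E.

(** The strict sublevel sets at levels above the infimum generate a proper filter on [C], and lower
    semicontinuity makes any of its cluster points a minimizer. If the infimum is [+oo] these sets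
    are empty, but then every point is a minimizer. *)
Lemma compact_lsc_min {X : topologicalType} (C : set X) (f : X -> \bar R) :
  C !=set0 -> compact C -> lower_semicontinuous_on C f ->
  exists2 x, C x & forall y, C y -> (f x <= f y)%E.
Proof.
move=> [x0 Cx0] cC fl.
pose m := ereal_inf (f @` C).
have mle y : C y -> (m <= f y)%E by move=> Cy; apply: ereal_inf_lbound; exists y.
have [my|] := eqVneq m +oo%E.
  by exists x0 => // y Cy; have := mle y Cy; rewrite my leye_eq => /eqP ->; exact: leey.
rewrite -ltey => mfin.
pose S (a : R) := [set y | C y /\ (f y < a%:E)%E].
pose F := filter_from [set a : R | (m < a%:E)%E] S.
have [a0 /andP[ma0 _]] := lte_between mfin.
have FF : ProperFilter F.
  apply: filter_from_proper.
    apply: filter_from_filter; first by exists a0.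
    move=> a b /= ma mb; exists (Num.min a b).
      by rewrite /= EFin_min lt_min ma mb.
    by move=> y [Cy]; rewrite EFin_min lt_min => /andP[ya yb]; split; split.
  move=> a /= ma.
  have [_ [y Cy <-] fya] : exists2 z, (f @` C) z & (z < a%:E)%E.
    exact: ereal_inf_lt.
  by exists y.
have FC : F C by exists a0 => //= y [].
have [x [Cx clx]] := cC F FF FC.
exists x => // y Cy; apply: le_trans (mle y Cy); rewrite leNgt; apply/negP => mfx.
have [a /andP[ma afx]] := lte_between mfx.
have [V xV Va] := fl x a Cx afx.
have [z [[Cz fz] Vz]] := clx (S a) V (ex_intro2 _ _ a ma (fun _ => id)) xV.
by have := lt_trans fz (Va z Vz Cz); rewrite ltxx.
Qed.

Context {n : nat}.
Implicit Types (u v : 'cV[R]_n) (C : set 'cV[R]_n) (f : 'cV[R]_n -> \bar R).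

(* Stated through real upper bounds of f, so that no extended arithmetic occurs. *)
Definition strongly_econvex C (s : R) f :=
  forall u v (a b t : R), C u -> C v -> 0 <= t <= 1 ->
    (f u <= a%:E)%E -> (f v <= b%:E)%E ->
    (f (t *: u + (1 - t) *: v)%R <=
      (t * a + (1 - t) * b - s / 2 * t * (1 - t) * enorm (u - v) ^+ 2)%:E)%E.

(** [C] may be unbounded. Strong convexity replaces coercivity: the minimum [a] over the unit ball
    around [x] confines all points better than [x] to a ball of radius [r], where compactness
    applies. *)
Lemma strongly_econvex_min C s f :
  closed C -> convex_set C -> 0 < s -> (forall u, f u != -oo%E) ->
  lower_semicontinuous_on C f -> strongly_econvex C s f ->
  (exists2 u, C u & (f u < +oo)%E) ->
  exists2 u, C u & forall v, C v -> (f u <= f v)%E.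
Proof.
move=> cC vC s0 fN fl fs [x Cx fxy].
have [b fx] : exists b, f x = b%:E.
  by move: fxy (fN x); case: (f x) => [r _ _| |] //; exists r.
have lsub D : D `<=` C -> lower_semicontinuous_on D f.
  move=> DC u a Du /(fl u a (DC _ Du))[V uV Va]; exists V => // y Vy /DC.
  exact: Va.
pose ball r := C `&` [set y | enorm (y - x) <= r].
have ballx r : 0 <= r -> ball r x by move=> r0; split; rewrite //= subrr enorm0.
have [z [Cz _] zmin] := compact_lsc_min (ex_intro _ x (ballx 1 ler01))
  (compact_eball (x := x) (r := 1) cC) (lsub _ (@subIsetl _ _ _)).
have [a fz] : exists a, f z = a%:E.
  have := zmin x (ballx 1 ler01); rewrite fx; move: (fN z).
  by case: (f z) => [r _ _| |] //; exists r.
(* If [f u < f x] with [u] at distance [e > 1] from [x], the point of the segment at distance 1 from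
   [x] has value at least [a], so strong convexity gives [a <= b - s / 2 * (e - 1)], that is
   [e <= r]. *)
pose r := 1 + 2 * (b - a) / s.
have ab : a <= b by rewrite -lee_fin -fz -fx; exact: zmin (ballx _ ler01).
have r1 : 1 <= r by rewrite lerDl divr_ge0 ?(ltW s0) // mulr_ge0 // subr_ge0.
have far u : C u -> r < enorm (u - x) -> (f x <= f u)%E.
  move=> Cu ru; rewrite leNgt; apply/negP => fu.
  set e := enorm (u - x) in ru.
  have e1 : 1 < e by exact: le_lt_trans ru.
  have e0 : 0 < e by exact: lt_trans e1.
  have tI : 0 <= e^-1 <= 1.
    by rewrite invr_ge0 (ltW e0) /= invf_le1 // ltW.
  have := fs u x b b e^-1 Cu Cx tI.
  rewrite -fx (ltW fu) lexx => /(_ isT isT).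
  have := zmin (e^-1 *: u + (1 - e^-1) *: x).
  rewrite -add_scale_subE fz => zm /(le_trans (zm _)) {zm}.
  rewrite lee_fin -/e => H; suff: s * (e - 1) <= 2 * (b - a).
    by rewrite leNgt => /negP; apply; rewrite (mulrC s) -ltr_pdivrMr // ltrBrDl.
  suff : a <= b - s / 2 * (e - 1) by lra.
  have <- : e^-1 * b + (1 - e^-1) * b - s / 2 * e^-1 * (1 - e^-1) * e ^+ 2
     = b - s / 2 * (e - 1) by field; rewrite gt_eqF.
  apply: H; split.
    by rewrite add_scale_subE; apply: (convex_setP vC).
  by rewrite /= addrAC subrr add0r enormZ -/e gtr0_norm ?invr_gt0 // mulVf ?gt_eqF.
have [u [Cu _] umin] := compact_lsc_min
  (ex_intro _ x (ballx r (le_trans ler01 r1)))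
  (compact_eball (x := x) (r := r) cC) (lsub _ (@subIsetl _ _ _)).
exists u => // v Cv; have [vr|vr] := leP (enorm (v - x)) r; first exact: umin.
apply: le_trans (far v Cv vr); apply: umin; apply: ballx.
exact: le_trans r1.
Qed.

Lemma strongly_econvex_min_uniq C s f u v (a : R) :
  0 < s -> convex_set C -> strongly_econvex C s f ->
  C u -> C v -> f u = a%:E -> f v = a%:E -> (forall x, C x -> (f u <= f x)%E) ->
  u = v.
Proof.
move=> s0 vC fs Cu Cv fu fv umin.
have tI : 0 <= (2^-1 : R) <= 1 by lra.
have := fs u v a a 2^-1 Cu Cv tI; rewrite fu fv lexx => /(_ isT isT).
move=> /(le_trans (umin _ (convex_setP vC Cu Cv tI))); rewrite fu lee_fin.
move=> H; apply/eqP; rewrite -subr_eq0 -enorm_eq0 -sqrf_eq0.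
have e2 := sqr_ge0 (enorm (u - v)).
rewrite eq_le e2 andbT -(pmulr_rle0 _ s0); nra.
Qed.

End Minimizers.

(** * The largest eigenvalue of the Gram matrix bounds its quadratic form *)

Section LargestEigenvalue.
Context {R : realType} {m n : nat}.
Implicit Types (A : 'M[R]_(m, n)) (x y : 'cV[R]_n).

Lemma dotv_trmx A x (y : 'cV[R]_m) : dotv (A *m x) y = dotv x (A^T *m y).
Proof. by rewrite !dotvE trmx_mul mulmxA. Qed.

Lemma cvg_mulmx A {T : topologicalType} (f : T -> 'cV[R]_n) (F : set_system T)
    {FF : Filter F} x : f @ F --> x -> (fun t => A *m f t) @ F --> A *m x.
Proof.
have AE z : A *m z = \sum_j z j 0 *: col j A.
  apply/colP => i; rewrite mxE summxE; apply: eq_bigr => j _.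
  by rewrite !mxE mulrC.
move=> fx; rewrite AE (_ : (fun t => _) = fun t => \sum_j f t j 0 *: col j A).
  apply: cvg_big => [|j _]; first exact: add_continuous.
  by apply: cvgZ; [exact: continuous_entry|exact: cvg_cst].
by apply/funext => t; rewrite AE.
Qed.

(* A maximizer of the Rayleigh quotient |A x|^2 / |x|^2 is an eigenvector of
   A^T A, so that the supremum defining lambda_max is its value there. *)
Lemma dotv_mulmx_le A x :
  dotv (A *m x) (A *m x) <= lambda_max (A^T *m A) * dotv x x.
Proof.
pose f y := dotv (A *m y) (A *m y).
have [->|xN0] := eqVneq x 0; first by rewrite mulmx0 !dotv0l mulr0.
pose C := setT `&` [set y : 'cV[R]_n | enorm (y - 0) <= 1].
have CE y : C y <-> enorm y <= 1 by rewrite /C /= subr0; split=> [[]|].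
have [x0 /set_mem/CE x0le x0max] : exists2 c, c \in C
    & forall y, y \in C -> f y <= f c.
  apply: compact_EVT_max.
  - by exists 0; apply/CE; rewrite enorm0.
  - exact: compact_eball closedT.
  - apply: continuous_subspaceT => y.
    by apply: (@cvg_dotv _ _ _ _ _ (nbhs y) _); apply: cvg_mulmx; exact: cvg_id.
pose a := f x0.
have fle y : f y <= a * dotv y y.
  have [->|yN0] := eqVneq y 0; first by rewrite /f mulmx0 !dotv0l mulr0.
  have e0 : 0 < enorm y by rewrite lt_neqAle enorm_ge0 eq_sym enorm_eq0 yN0.
  have := x0max ((enorm y)^-1 *: y); rewrite inE => /(_ _).
  have yC : C ((enorm y)^-1 *: y).
    by apply/CE; rewrite enormZ gtr0_norm ?invr_gt0 // mulVf ?gt_eqF.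
  move=> /(_ yC); rewrite /f -scalemxAr !dotv_lin mulrA -expr2 -/(f y) -/(f x0).
  by rewrite exprVn mulrC ler_pdivrMr ?exprn_gt0 // sqr_enorm.
have [y [yN0 fy]] : exists y, y != 0 /\ f y = a * dotv y y.
  have a0 : 0 <= a by exact: dotvv_ge0.
  have fx0 : f x0 = a * dotv x0 x0.
    apply/eqP; rewrite eq_le fle /= -sqr_enorm ler_piMr //.
    by rewrite exprn_ile1 ?enorm_ge0.
  (* The maximizer on the ball can be zero only if [a = 0]; then the nonzero [x] also satisfies the
     equality. *)
  have [x00|x00] := eqVneq x0 0; last by exists x0.
  exists x; split => //; apply/eqP; rewrite eq_le fle /=.
  suff -> : a = 0 by rewrite mul0r dotvv_ge0.
  by rewrite /a /f x00 mulmx0 dotv0l.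
have yeig : A^T *m A *m y = a *: y.
  (* [M] is symmetric, its form is nonpositive, and the form vanishes at [y]. Perturbing [y] by
     [t *: M y] with small [t > 0] would make it positive unless [M y = 0]. *)
  pose M (z : 'cV[R]_n) := A^T *m (A *m z) - a *: z.
  have MD u v (t : R) : M (u + t *: v) = M u + t *: M v.
    rewrite /M !mulmxDr -!scalemxAr !scalerDr scalerN opprD addrACA.
    by rewrite !scalerA (mulrC a).
  have Mle z : dotv z (M z) <= 0.
    by rewrite !dotv_lin -dotv_trmx subr_le0 fle.
  have My0 : dotv y (M y) = 0.
    by rewrite !dotv_lin -dotv_trmx -/(f y) fy subrr.
  have Msym z : dotv z (M y) = dotv y (M z).
    by rewrite !dotv_lin -!dotv_trmx dotvC (dotvC z y).
  pose z := M y; pose c := dotv z (M z); pose d := dotv z z.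
  have yz : dotv y z = 0 by exact: My0.
  have yMz : dotv y (M z) = d by rewrite -Msym.
  have quad (t : R) (p q r s : 'cV[R]_n) : dotv (p + t *: q) (r + t *: s) =
      dotv p r + t * (dotv p s + dotv q r) + t ^+ 2 * dotv q s.
    by rewrite !dotv_lin; ring.
  have key (t : R) : 0 < t -> 2 * d <= t * - c.
    move=> t0; have := Mle (y + t *: z).
    rewrite MD.
    rewrite quad -/z yz yMz -/d -/c => H.
    rewrite -(ler_pM2l t0); move: H; nra.
  have c0 : c <= 0 by exact: Mle.
  have d0 : d = 0.
    apply/eqP; rewrite eq_le dotvv_ge0 andbT.
    have [cE|cN0] := eqVneq c 0; first by have := key 1 ltr01; rewrite cE; lra.
    have cl0 : 0 < - c by rewrite oppr_gt0 lt_neqAle cN0.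
    rewrite leNgt; apply/negP => dp.
    have := key (d / - c) (divr_gt0 dp cl0); rewrite divfK ?gt_eqF //; lra.
  by apply/eqP; rewrite -subr_eq0 -mulmxA -/(M y) -dotvv_eq0 -/z -/d d0.
have Msym : (A^T *m A)^T = A^T *m A by rewrite trmx_mul trmxK.
have eiga : eigenvalue (A^T *m A) a.
  apply/eigenvalueP; exists y^T; first by rewrite -{1}Msym -trmx_mul yeig linearZ.
  by apply: contra yN0 => /eqP y0; rewrite -[y]trmxK y0 trmx0.
apply: le_trans (fle x) _; apply: ler_wpM2r; first exact: dotvv_ge0.
apply: (@ub_le_sup R [set a | eigenvalue (A^T *m A) a]) => //.
exists a => b /= /eigenvalueP[v vb vN0].
have vtN0 : v^T != 0 by apply: contra vN0 => /eqP v0; rewrite -[v]trmxK v0 trmx0.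
have vp : 0 < dotv v^T v^T by rewrite lt_neqAle eq_sym dotvv_eq0 vtN0 dotvv_ge0.
rewrite -(ler_pM2r vp); apply: le_trans (fle v^T).
rewrite /f dotv_trmx mulmxA -{1}Msym -trmx_mul vb linearZ /= dotvZr.
exact: lexx.
Qed.

End LargestEigenvalue.

(** * Block decomposition and single-block updates *)

Section Blocks.
Context {R : realType} {N : nat} {dim : 'I_N -> nat}.
Local Notation V := 'cV[R]_(\sum_i dim i).
Implicit Types (u v d : V) (i j : 'I_N).

Definition update_block u i v : V :=
  \mxcol_j (if j == i then submxcol v j else submxcol u j).

Lemma submxcol_update u i v j :
  submxcol (update_block u i v) j = submxcol (if j == i then v else u) j.
Proof. by rewrite mxcolK; case: eqP. Qed.

Lemma submxcolZ (a : R) u j : submxcol (a *: u) j = a *: submxcol u j.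
Proof. by apply/matrixP => k l; rewrite !mxE. Qed.

Lemma submxcol_add u v j : submxcol (u + v) j = submxcol u j + submxcol v j.
Proof. exact: submxcolD. Qed.

Lemma submxcol_sub u v j : submxcol (u - v) j = submxcol u j - submxcol v j.
Proof. exact: submxcolB. Qed.

Lemma dotv_blocks u v : dotv u v = \sum_j dotv (submxcol u j) (submxcol v j).
Proof.
rewrite dotvE -{1}(submxcolK u) -{1}(submxcolK v) tr_mxcol mul_mxrow_mxcol summxE.
by apply: eq_bigr => j _; rewrite dotvE.
Qed.

Lemma mulmx_blocks m (A : 'M[R]_(m, \sum_i dim i)) u :
  A *m u = \sum_j submxrow A j *m submxcol u j.
Proof. by rewrite -{1}(submxrowK A) -{1}(submxcolK u) mul_mxrow_mxcol. Qed.

Lemma dotv_update_sub u i v x :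
  dotv x (update_block u i v - u) = dotv (submxcol x i) (submxcol (v - u) i).
Proof.
rewrite dotv_blocks (bigD1 i) //= submxcol_sub submxcol_update eqxx -submxcol_sub.
rewrite [X in _ + X]big1 ?addr0 // => j /negPf ji.
by rewrite submxcol_sub submxcol_update ji subrr dotv0r.
Qed.

Lemma mulmx_update_sub m (A : 'M[R]_(m, \sum_i dim i)) u i v :
  A *m (update_block u i v - u) = submxrow A i *m submxcol (v - u) i.
Proof.
rewrite mulmx_blocks (bigD1 i) //= !submxcol_sub submxcol_update eqxx.
rewrite [X in _ + X]big1 ?addr0 // => j /negPf ji.
by rewrite submxcol_sub submxcol_update ji subrr mulmx0.
Qed.

(** Sums over [i] of this kind are [N] times the mean over a uniformly drawn block: block-additive
    quantities recover their full increment from [u] to [v]. *)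
Lemma sum_dotv_update u v x :
  \sum_i dotv x (update_block u i v - u) = dotv x (v - u).
Proof. by rewrite [RHS]dotv_blocks; apply: eq_bigr => i _; rewrite dotv_update_sub. Qed.

Lemma dotvv_update_sub u i v :
  dotv (update_block u i v - u) (update_block u i v - u)
    = dotv (submxcol (v - u) i) (submxcol (v - u) i).
Proof. by rewrite dotv_update_sub !submxcol_sub submxcol_update eqxx. Qed.

Lemma sum_dotvv_update u v :
  \sum_i dotv (update_block u i v - u) (update_block u i v - u) = dotv (v - u) (v - u).
Proof. by rewrite [RHS]dotv_blocks; apply: eq_bigr => i _; rewrite dotvv_update_sub. Qed.

Lemma sum_separable_update (f : 'I_N -> V -> R) u v :
  (forall i j, f j (update_block u i v) = f j (if j == i then v else u)) ->
  \sum_i (\sum_j f j (update_block u i v) - \sum_j f j u)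
    = \sum_j f j v - \sum_j f j u.
Proof.
move=> fE; rewrite -[RHS]sumrB; apply: eq_bigr => i _.
rewrite -sumrB (bigD1 i) //= fE eqxx [X in _ + X]big1 ?addr0 // => j /negPf ji.
by rewrite fE ji subrr.
Qed.

Lemma prod_blocks_update (Ub : forall i, set 'cV[R]_(dim i)) u i v :
  prod_blocks Ub u -> prod_blocks Ub v -> prod_blocks Ub (update_block u i v).
Proof. by move=> Uu Uv j; rewrite submxcol_update; case: eqP. Qed.

End Blocks.

(** * Bregman distance of a block-separable core function *)

Section SeparableCore.
Context {R : realType} {N : nat} {dim : 'I_N -> nat}.
Local Notation V := 'cV[R]_(\sum_i dim i).
Context (Ub : forall i, set 'cV[R]_(dim i)) (K : V -> R).
Context (Kb : forall i, 'cV[R]_(dim i) -> R).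
Local Notation U := (prod_blocks Ub).
Implicit Types (u v x : V) (i j : 'I_N).

Definition block_bregman j u v : R :=
  Kb (submxcol u j) - Kb (submxcol v j)
    - dotv (submxcol (grad K v) j) (submxcol (u - v) j).

Context (KE : forall u, U u -> K u = \sum_j Kb (submxcol u j)).
Context (dK : forall u, U u -> differentiable K u).
Context (cU : convex_set U).

Lemma bregman_blocks u v : U u -> U v ->
  bregman K u v = \sum_j block_bregman j u v.
Proof.
move=> Uu Uv; rewrite /bregman !KE // dotv_blocks -!sumrB.
by apply: eq_bigr.
Qed.

(* grad K v also has components orthogonal to U, about which separability on U
   says nothing; in feasible directions it is a limit of difference quotients
   of Kb alone. *)
Lemma dotv_grad_block j x v v' : U x -> U v -> U v' ->
  submxcol v j = submxcol v' j ->
  dotv (submxcol (grad K v) j) (submxcol (x - v) j)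
    = dotv (submxcol (grad K v') j) (submxcol (x - v') j).
Proof.
move=> Ux Uv Uv' vv'.
pose q y t := t^-1 * (K (y + t *: (update_block y j x - y)) - K y).
have lim y : U y -> (q y : R -> R) @ 0^'+ -->
    dotv (submxcol (grad K y) j) (submxcol (x - y) j).
  by move=> Uy; rewrite -dotv_update_sub; apply: cvg_dirderiv; exact: dK.
have Kinc y t : U y -> 0 <= t <= 1 -> K (y + t *: (update_block y j x - y)) - K y
    = Kb (submxcol y j + t *: (submxcol (x - y) j)) - Kb (submxcol y j).
  move=> Uy tI; have Uy' : U (y + t *: (update_block y j x - y)).
    rewrite add_scale_subE; apply: (convex_setP cU) => //.
    exact: prod_blocks_update.
  rewrite !KE // -sumrB (bigD1 j) //= [X in _ + X]big1 ?addr0 => [|k /negPf kj].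
    by rewrite submxcol_add submxcolZ submxcol_sub submxcol_update eqxx -submxcol_sub.
  by rewrite submxcol_add submxcolZ submxcol_sub submxcol_update kj subrr scaler0 addr0 subrr.
have qq : \forall t \near 0^'+, q v t = q v' t.
  near=> t; have t0 : 0 < t by [].
  have tI : 0 <= t <= 1 by rewrite (ltW t0) /=; near: t; exact: nbhs_right_le.
  rewrite /q (Kinc v) // (Kinc v') // !submxcol_sub.
  by rewrite vv'.
apply/eqP; rewrite eq_le; apply/andP; split.
  have := @ler_limits R R (0^'+) _ _ _ _ _ (lim v Uv) (lim v' Uv'); apply.
  by apply: filterS qq => t ->.
have := @ler_limits R R (0^'+) _ _ _ _ _ (lim v' Uv') (lim v Uv); apply.
by apply: filterS qq => t ->.
Unshelve. all: by end_near. Qed.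

(** [block_bregman] mentions the gradient at the whole vector [v]; by [dotv_grad_block] its value
    nevertheless depends on the [j]-th blocks alone. *)
Lemma block_bregman_eq j u u' v v' : U u -> U u' -> U v -> U v' ->
  submxcol u j = submxcol u' j -> submxcol v j = submxcol v' j ->
  block_bregman j u v = block_bregman j u' v'.
Proof.
move=> Uu Uu' Uv Uv' uu' vv'; rewrite /block_bregman uu' vv'.
by rewrite (@dotv_grad_block j u v v') // !submxcol_sub uu'.
Qed.

Lemma sum_bregman_update x u v : U x -> U u -> U v ->
  \sum_i (bregman K x (update_block u i v) - bregman K x u)
    = bregman K x v - bregman K x u.
Proof.
move=> Ux Uu Uv; rewrite !bregman_blocks //.
rewrite -(@sum_separable_update _ _ _ (fun j => block_bregman j x)) => [|i j].
  by apply: eq_bigr => i _; rewrite bregman_blocks //; exact: prod_blocks_update.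
apply: block_bregman_eq => //; first exact: prod_blocks_update.
  by case: eqP.
by rewrite submxcol_update.
Qed.

(** Separates the cost of moving block [i] from the cost of moving all other blocks; this is what
    decouples the subproblem of a step. *)
Lemma bregman_update_split u i x v : U u -> U x -> U v ->
  bregman K v u = bregman K (update_block u i v) u + bregman K (update_block v i u) u.
Proof.
move=> Uu Ux Uv.
have Uuv := prod_blocks_update i Uu Uv; have Uvu := prod_blocks_update i Uv Uu.
rewrite !bregman_blocks // -big_split /=; apply: eq_bigr => j _.
have zero y : U y -> submxcol y j = submxcol u j -> block_bregman j y u = 0.
  by move=> Uy yu; rewrite /block_bregman submxcol_sub yu !subrr dotv0r subr0.
have [ji|ji] := eqVneq j i.
  rewrite (zero (update_block v i u)) ?submxcol_update ?ji ?eqxx // addr0.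
  by apply: block_bregman_eq => //; rewrite submxcol_update eqxx.
rewrite (zero (update_block u i v)) ?submxcol_update ?(negPf ji) // add0r.
by apply: block_bregman_eq => //; rewrite submxcol_update (negPf ji).
Qed.

End SeparableCore.

(** * Histories of independent uniform draws *)

Section UniformTree.
Context {R : realType} {disp : measure_display} {Omega : measurableType disp}.
Context (P : probability Omega R) {N : nat} (idx : nat -> Omega -> 'I_N).
Context (N_gt0 : (0 < N)%N) (idx_iid : iid_uniform P idx).
Implicit Types (s t : seq 'I_N) (w : Omega).

Definition history (k : nat) w : seq 'I_N := mkseq (fun j => idx j w) k.

Lemma size_history k w : size (history k w) = k.
Proof. exact: size_mkseq. Qed.

Lemma historyS k w : history k.+1 w = rcons (history k w) (idx k w).
Proof. exact: mkseqS. Qed.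

Lemma take_history j k w : (j <= k)%N -> take j (history k w) = history j w.
Proof. by move=> jk; rewrite /history /mkseq -map_take take_iota (minn_idPl jk). Qed.

(** There are finitely many histories of length [k], so an arbitrary [S] gives an event; the
    induction splits on the last draw. *)
Lemma measurable_history k (S : set (seq 'I_N)) :
  measurable [set w | S (history k w)].
Proof.
have [idx_meas _ _] := idx_iid.
elim: k S => [|k IH] S.
  have [S0|S0] := pselect (S [::]).
    by rewrite (_ : mkset _ = setT); [exact: measurableT|apply/seteqP; split].
  by rewrite (_ : mkset _ = set0); [exact: measurable0|apply/seteqP; split].
rewrite (_ : mkset _ = \bigcup_(i in [set: 'I_N])
    (idx k @^-1` [set i] `&` [set w | S (rcons (history k w) i)])).
  apply: fin_bigcup_measurable => // i _; apply: measurableI; first exact: idx_meas.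
  exact: (IH [set s | S (rcons s i)]).
apply/seteqP; split => w /=; rewrite historyS.
  by move=> Sw; exists (idx k w).
by case=> i _ [/= -> ].
Qed.

Lemma prob_history s : (P [set w | history (size s) w = s] = (N%:R^-1 ^+ size s)%:E)%E.
Proof.
have [_ idx_unif idx_ind] := idx_iid.
have i0 : 'I_N := Ordinal N_gt0.
have -> : [set w | history (size s) w = s] =
    \bigcap_(k in [set` iota 0 (size s)]) (idx k @^-1` [set nth i0 s k]).
  apply/seteqP; split=> w /= hw.
    move=> k /=; rewrite mem_iota /= add0n => ks.
    by rewrite -[in RHS]hw nth_mkseq.
  apply: (@eq_from_nth _ i0) => [|k]; rewrite size_history // => ks.
  by rewrite nth_mkseq //; apply: hw; rewrite /= mem_iota.
rewrite (idx_ind _ (fun k => [set nth i0 s k])) ?iota_uniq //.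
under eq_bigr do rewrite idx_unif.
elim: (size s) 0%N => [|k IH] j; first by rewrite big_nil expr0.
by rewrite big_cons IH exprS EFinM.
Qed.

(** * Nonnegative supermartingales on the tree of draws *)

Section Supermartingale.
Context (D : set (seq 'I_N)) (Z : seq 'I_N -> R).
Context (D_rcons : forall s i, D s -> D (rcons s i)).
Context (Z_ge0 : forall s, D s -> 0 <= Z s).
Context (Z_super : forall s, D s -> \sum_i Z (rcons s i) <= N%:R * Z s).

(** The event is cut down to the paths through node [s], so that an induction on the horizon [n] can
    pass from [s] to its children. *)
Definition exceeds (M : R) (n : nat) s : set Omega :=
  [set w | history (size s) w = s /\
     exists2 k, (k <= n)%N & M < Z (history (size s + k) w)].

Lemma measurable_exceeds M n s : measurable (exceeds M n s).
Proof.
rewrite (_ : exceeds M n s = [set w | [set t | take (size s) t = s /\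
    exists2 k, (k <= n)%N & M < Z (take (size s + k) t)] (history (size s + n) w)]).
  exact: measurable_history.
apply/seteqP; split=> w [hs [k kn Mk]]; split.
- by rewrite take_history ?leq_addr.
- by exists k => //; rewrite take_history // leq_add2l.
- by move: hs; rewrite take_history ?leq_addr.
- by exists k => //; move: Mk; rewrite take_history // leq_add2l.
Qed.

Lemma prob_le_sum (E : set Omega) (F : 'I_N -> set Omega) :
  measurable E -> (forall i, measurable (F i)) -> E `<=` \bigcup_i F i ->
  (P E <= \sum_i P (F i))%E.
Proof.
move=> mE mF EF.
pose A (k : nat) := if insub k is Some i then F i else set0.
have AF (i : 'I_N) : A i = F i by rewrite /A valK.
have mA k : measurable (A k) by rewrite /A; case: insubP.
have EA : E `<=` \big[setU/set0]_(k < N) A k.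
  move=> w /EF[i _ Fi]; rewrite -bigcup_mkord; exists i => //=.
  by rewrite AF.
apply: le_trans (le_measure P _ _ EA) _; rewrite ?inE //.
  exact: bigsetU_measurable.
apply: le_trans (Boole_inequality P (fun i _ => mA i)) _.
by apply: lee_sum => i _; rewrite AF.
Qed.

(** The event lies in the cylinder of [s], whose probability is [N%:R^-1 ^+ size s], and here the
    factor [Z s / M] exceeds 1. *)
Lemma exceeds_gt M n s : M < Z s -> 0 < M ->
  (P (exceeds M n s) <= (Z s / M * N%:R^-1 ^+ size s)%:E)%E.
Proof.
move=> sM M0; apply: (@le_trans _ _ (N%:R^-1 ^+ size s)%:E).
  rewrite -prob_history; apply: le_measure; rewrite ?inE.
  - exact: measurable_exceeds.
  - exact: (measurable_history _ [set t | t = s]).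
  - by move=> w [].
rewrite lee_fin ler_peMl ?exprn_ge0 ?invr_ge0 //.
by rewrite ler_pdivlMr // mul1r ltW.
Qed.

(* Ville's maximal inequality, by conditioning on the next draw. *)
Lemma prob_exceeds_le M n s : 0 < M -> D s ->
  (P (exceeds M n s) <= (Z s / M * N%:R^-1 ^+ size s)%:E)%E.
Proof.
have n0 : 0 < N%:R :> R by rewrite ltr0n.
move=> M0; elim: n s => [|n IH] s Ds; have [sM|sM] := ltP M (Z s).
- exact: exceeds_gt.
- rewrite (_ : exceeds M 0 s = set0) ?measure0 ?lee_fin.
    by rewrite mulr_ge0 ?divr_ge0 ?exprn_ge0 ?invr_ge0 ?Z_ge0 // ltW.
  apply/seteqP; split=> // w [hs [k]]; rewrite leqn0 => /eqP ->.
  by rewrite addn0 hs ltNge sM.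
- exact: exceeds_gt.
apply: le_trans (@prob_le_sum _ (fun i => exceeds M n (rcons s i)) _ _ _) _.
- exact: measurable_exceeds.
- by move=> i; exact: measurable_exceeds.
- move=> w [hs [[|k] kn Mk]]; first by move: Mk; rewrite addn0 hs ltNge sM.
  exists (idx (size s) w) => //; split; first by rewrite size_rcons historyS hs.
  by exists k => //; rewrite size_rcons addSnnS.
apply: le_trans (lee_sum _ (fun i _ => IH _ (D_rcons i Ds))) _.
rewrite sumEFin lee_fin; under eq_bigr do rewrite size_rcons -mulrA.
rewrite -mulr_suml exprS mulrCA mulrA -mulrA [Z s * _]mulrC.
rewrite (mulrC (\sum_i _)) -!mulrA ler_wpM2l ?invr_ge0 ?(ltW M0) //.
by rewrite ler_pdivrMl // mulrC mulrA ler_wpM2r ?Z_super // exprn_ge0 // invr_ge0 ltW.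
Qed.

Lemma prob_exceeds_any_le M s : 0 < M -> D s ->
  (P (\bigcup_n exceeds M n s) <= (Z s / M * N%:R^-1 ^+ size s)%:E)%E.
Proof.
move=> M0 Ds; have mE n := measurable_exceeds M n s.
have cvgE := @nondecreasing_cvg_mu _ _ _ P (fun n => exceeds M n s) mE
  (bigcup_measurable (fun n _ => mE n)).
rewrite -(cvg_lim _ (cvgE _)) //.
  apply: lime_le; last by apply: nearW => n; exact: prob_exceeds_le.
  apply/cvg_ex; eexists; apply: cvgE.
all: move=> j k jk; apply/subsetPset => w [hs [i ij Mi]]; split=> //.
all: by exists i => //; exact: leq_trans jk.
Qed.

Lemma negligible_unbounded s : D s ->
  P.-negligible [set w | history (size s) w = s /\
    forall M, exists k, M < Z (history (size s + k) w)].
Proof.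
move=> Ds; pose E (j : nat) := \bigcup_n exceeds j.+1%:R n s.
have mE j : measurable (E j).
  by apply: bigcup_measurable => n _; exact: measurable_exceeds.
have mB : measurable (\bigcap_j E j) by exact: bigcapT_measurable.
exists (\bigcap_j E j); split=> //; last first.
  move=> w [hs unb] j _; have [k Mk] := unb j.+1%:R.
  by exists k => //; split=> //; exists k.
have le j : (P (\bigcap_j E j) <= (Z s * N%:R^-1 ^+ size s * j.+1%:R^-1)%:E)%E.
  have sub : \bigcap_j E j `<=` E j by move=> w /(_ j I).
  apply: le_trans (le_measure P _ _ sub) _; rewrite ?inE //.
  by rewrite mulrAC prob_exceeds_any_le.
have fP : P (\bigcap_j E j) \is a fin_num by exact: fin_num_measure.
apply/eqP; rewrite eq_le measure_ge0 andbT -(fineK fP) lee_fin.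
have c0 : (fun j : nat => Z s * N%:R^-1 ^+ size s * j.+1%:R^-1) @ \oo --> (0 : R).
  rewrite -(mulr0 (Z s * N%:R^-1 ^+ size s)); apply: cvgM; first exact: cvg_cst.
  exact: cvg_harmonic.
have := ler_limits (@cvg_cst _ (fine (P (\bigcap_j E j))) _ \oo _) c0; apply.
by apply: nearW => j; rewrite -lee_fin fineK.
Qed.

(** The time [l] at which [D] is entered may depend on the path. The null sets are therefore
    collected over all nodes [s], which [unpickle] enumerates. *)
Lemma ae_history_bounded :
  {ae P, forall w, forall l, D (history l w) ->
    exists M, forall k, Z (history (l + k) w) <= M}.
Proof.
have ae_s : {ae P, forall w, forall n : nat, forall s, unpickle n = Some s -> D s ->
    history (size s) w = s -> exists M, forall k, Z (history (size s + k) w) <= M}.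
  apply: ae_foralln => n; case E: (unpickle n) => [s|]; last exact: aeW.
  have [Ds|Ds] := pselect (D s); last by apply: aeW => w _ [<-].
  have [B [mB B0 sB]] := negligible_unbounded Ds; exists B; split=> // w nw.
  apply: sB; have [hs|hs] := pselect (history (size s) w = s); last first.
    by exfalso; apply: nw => _ [<-].
  split=> // M; apply: contrapT => nM; apply: nw => _ [<-] _ _; exists M => k.
  by rewrite leNgt; apply/negP => Mk; apply: nM; exists k.
apply: filterS ae_s => w ws l Dl.
have := ws (pickle (history l w)) (history l w); rewrite pickleK size_history.
exact.
Qed.

End Supermartingale.

(** A second use of the supermartingale bound. Let [Z] be [a ^+ k] while [i] is absent from the
    first [k] draws and 0 afterwards; it is a supermartingale because [(N - 1) * a = N - 1 / N], and
    it is unbounded on any path that never draws [i]. *)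
Lemma ae_history_covers :
  {ae P, forall w, exists l, forall i, i \in history l w}.
Proof.
have n0 : 0 < N%:R :> R by rewrite ltr0n.
pose a : R := 1 + N%:R^-1.
have a0 : 0 <= a by rewrite addr_ge0 // invr_ge0 ltW.
have bernoulli k : 1 + k%:R / N%:R <= a ^+ k.
  elim: k => [|k IH]; first by rewrite mul0r addr0.
  rewrite exprS; apply: le_trans (ler_wpM2l a0 IH); rewrite -natr1 /a.
  have : 0 <= N%:R^-1 * (k%:R / N%:R) :> R by rewrite mulr_ge0 // ?divr_ge0 // ?invr_ge0 ltW.
  by lra.
have one i : {ae P, forall w, exists l, i \in history l w}.
  pose Z s : R := if i \in s then 0 else a ^+ size s.
  have Z0 s : setT s -> 0 <= Z s by rewrite /Z; case: ifP => // _ _; exact: exprn_ge0.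
  have Zsup s : setT s -> \sum_j Z (rcons s j) <= N%:R * Z s.
    move=> _; rewrite /Z; case: ifPn => [si|si].
      by rewrite mulr0 big1 // => j _; rewrite mem_rcons inE si orbT.
    rewrite (bigD1 i) //= mem_rcons inE eqxx add0r.
    rewrite (eq_bigr (fun=> a * a ^+ size s)) => [|j ji]; last first.
      by rewrite mem_rcons inE eq_sym (negPf ji) (negPf si) size_rcons exprS.
    rewrite sumr_const cardC1 card_ord -[X in X <= _]mulr_natl mulrA.
    apply: ler_wpM2r; first exact: exprn_ge0.
    have -> : N.-1%:R * a = N%:R - N%:R^-1.
      by rewrite -subn1 natrB // /a; field; rewrite gt_eqF.
    by rewrite gerBl invr_ge0 ltW.
  have := @ae_history_bounded setT Z (fun _ _ _ => I) Z0 Zsup.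
  apply: filterS => w /(_ 0%N I)[M ZM]; apply: contrapT => nl.
  have := ZM (Num.bound (`|M| * N%:R)); rewrite add0n /Z ifF; last first.
    by apply/negP => il; apply: nl; eexists; exact: il.
  rewrite size_history leNgt => /negP; apply; apply: lt_le_trans (bernoulli _).
  apply: le_lt_trans (ler_norm M) _.
  apply: (@lt_le_trans _ _ ((Num.bound (`|M| * N%:R))%:R / N%:R)).
    by rewrite ltr_pdivlMr // archi_boundP // mulr_ge0 // ltW.
  by rewrite lerDr.
have all_i : {ae P, forall w, forall k, forall i : 'I_N, k = i :> nat ->
    exists l, i \in history l w}.
  apply: ae_foralln => k; have [kN|kN] := ltnP k N.
    apply: filterS (one (Ordinal kN)) => w hw i ki.
    by rewrite (_ : i = Ordinal kN) //; exact: val_inj.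
  by apply: aeW => w i ki; move: (ltn_ord i); rewrite -ki ltnNge kN.
apply: filterS all_i => w hw.
have /choice[l hl] : forall i : 'I_N, exists l, i \in history l w by move=> i; exact: (hw i i).
exists (\max_i l i) => i.
have := hl i; rewrite -(take_history (k := \max_i l i) w); first exact: mem_take.
exact: leq_bigmax.
Qed.

End UniformTree.

(** * Extended-valued convex functions and their block sums *)

Lemma convex_efunction_epi {R : realType} {n : nat} (C : set 'cV[R]_n)
    (f : 'cV[R]_n -> \bar R) u v (t a c : R) :
  convex_efunction C f -> C u -> C v -> 0 <= t <= 1 ->
  (f u <= a%:E)%E -> (f v <= c%:E)%E ->
  (f (t *: u + (1 - t) *: v)%R <= (t * a + (1 - t) * c)%:E)%E.
Proof.
move=> cf Cu Cv /[dup] tI /andP[t0 t1] fu fv; apply: le_trans (cf u v t Cu Cv tI) _.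
rewrite [leRHS]EFinD !EFinM; apply: leeD; apply: lee_wpmul2l => //.
by rewrite lee_fin subr_ge0.
Qed.

Section SumBlocks.
Context {R : realType} {N : nat} {dim : 'I_N -> nat}.
Context (Jb : forall i, 'cV[R]_(dim i) -> \bar R).
Context (JN : forall i (x : 'cV[R]_(dim i)), Jb x != -oo%E).
Local Notation J := (sum_blocks Jb).
Implicit Types u v : 'cV[R]_(\sum_i dim i).

Lemma sum_blocks_ltyP u : (J u < +oo)%E <-> forall i, (Jb (submxcol u i) < +oo)%E.
Proof.
split=> [Ju i|Ju]; last by apply: lte_sum_pinfty => i _; exact: Ju.
rewrite ltey; apply/eqP => Jui; move: Ju; rewrite ltey => /eqP; apply.
by apply/esum_eqyP => [j _|]; [exact: JN|exists i; split=> //; exact: mem_index_enum].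
Qed.

Lemma block_fin_num u i : (J u < +oo)%E -> Jb (submxcol u i) \is a fin_num.
Proof. by move=> /sum_blocks_ltyP Ju; rewrite fin_numE JN -ltey Ju. Qed.

(** [fine] sends [+oo] to 0, so this represents [Jb] faithfully only where [J] is finite. *)
Definition fine_block i u : R := fine (Jb (submxcol u i)).

Lemma sum_blocks_fineE u : (J u < +oo)%E -> J u = (\sum_i fine_block i u)%:E.
Proof.
by move=> Ju; rewrite /sum_blocks -EFin_sum_fine // => i _; exact: block_fin_num.
Qed.

Lemma sum_blocks_neqNy u : J u != -oo%E.
Proof.
by apply/eqP => /esum_eqNyP[i [_ _ /eqP]]; rewrite (negPf (JN _)).
Qed.

End SumBlocks.

(** * The reference subproblem and its optimality condition *)

Section RPDC.
Context {R : realType} {N m : nat} {dim : 'I_N -> nat}.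
Local Notation V := 'cV[R]_(\sum_i dim i).
Context (A : 'M[R]_(m, \sum_i dim i)) (b : 'cV[R]_m).
Context (Ub : forall i, set 'cV[R]_(dim i)) (G : V -> R).
Context (Jb : forall i, 'cV[R]_(dim i) -> \bar R) (K : V -> R).
Context (beta gamma eps rho : R) (Kb : forall i, 'cV[R]_(dim i) -> R).
Local Notation U := (prod_blocks Ub).
Local Notation J := (sum_blocks Jb).
Local Notation step := (rpdc_step A b Ub G Jb K gamma eps rho).
Local Notation q := (qmult A b gamma).
Local Notation D := (bregman K).
Implicit Types (u v : V) (w : V * 'cV[R]_m).

Definition ref_primal w : V := (ref_point A b Ub G Jb K gamma eps w).1.
Local Notation T := ref_primal.

(** The differential at [w.1] of G(u) + <p, A u - b> + gamma/2 |A u - b|^2, the smooth part of the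
    augmented Lagrangian: its linear constraint term carries the multiplier [q w]. *)
Definition slope w u : R := dotv (grad G w.1) u + dotv (q w) (A *m u).

Definition ref_smooth w u : R := slope w u + eps^-1 * D u w.1.

Context (clU : closed U) (cvU : convex_set U).
Context (JN : forall i (x : 'cV[R]_(dim i)), Jb x != -oo%E).
Context (Jcv : convex_efunction setT J) (Jlsc : lower_semicontinuous J).
Context (Jdom : exists2 u, U u & (J u < +oo)%E).
Context (KE : forall u, U u -> K u = \sum_j Kb (submxcol u j)).
Context (Ksc : strongly_convex U beta K).
Context (dK : forall u, U u -> differentiable K u).
Context (eps_gt0 : 0 < eps).

Lemma ref_subobjE w u :
  ref_subobj A b G Jb K gamma eps w u = (J u + (ref_smooth w u)%:E)%E.
Proof. by rewrite /ref_subobj (addeC _ (J u)) -!addeA -!EFinD addrA. Qed.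

Lemma slopeD w u v : slope w (u + v) = slope w u + slope w v.
Proof. by rewrite /slope mulmxDr !dotvDr; ring. Qed.

Lemma slopeZ w a u : slope w (a *: u) = a * slope w u.
Proof. by rewrite /slope -scalemxAr !dotvZr; ring. Qed.

Lemma slopeB w u v : slope w (u - v) = slope w u - slope w v.
Proof. by rewrite -scaleN1r slopeD slopeZ mulN1r. Qed.

Lemma ref_subobj_strongly_econvex w :
  strongly_econvex U (beta / eps) (ref_subobj A b G Jb K gamma eps w).
Proof.
move=> u v a c t Uu Uv tI; rewrite !ref_subobjE -!leeBrDr // -!EFinB => Ju Jv.
apply: le_trans (convex_efunction_epi Jcv I I tI Ju Jv) _; rewrite lee_fin.
have Kuv := Ksc.2 u v t Uu Uv tI.
rewrite /ref_smooth slopeD !slopeZ.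
have e0 : 0 < eps^-1 by rewrite invr_gt0.
have : eps^-1 * D (t *: u + (1 - t) *: v) w.1 <= eps^-1 * (t * D u w.1
   + (1 - t) * D v w.1 - beta / 2 * t * (1 - t) * enorm (u - v) ^+ 2).
  rewrite ler_pM2l // /bregman.
  have -> : t *: u + (1 - t) *: v - w.1 = t *: (u - w.1) + (1 - t) *: (v - w.1).
    rewrite !scalerBr addrACA -opprD -scalerDl; congr (_ - _).
    by rewrite addrCA subrr addr0 scale1r.
  by rewrite !dotv_lin; move: Kuv; lra.
have -> : beta / eps / 2 * t * (1 - t) * enorm (u - v) ^+ 2 =
   eps^-1 * (beta / 2 * t * (1 - t) * enorm (u - v) ^+ 2).
  by field; rewrite gt_eqF.
lra.
Qed.

Lemma ref_subobj_lsc w :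
  lower_semicontinuous_on U (ref_subobj A b G Jb K gamma eps w).
Proof.
move=> x a Ux; rewrite ref_subobjE => ax.
have cg : (fun y => ref_smooth w y) @ nbhs x --> ref_smooth w x.
  rewrite /ref_smooth /slope /bregman.
  have idx : (fun y : V => y) @ nbhs x --> x by exact: cvg_id.
  apply: cvgD; first apply: cvgD.
  - by apply: cvg_dotv => //; exact: cvg_cst.
  - by apply: cvg_dotv; [exact: cvg_cst|exact: cvg_mulmx].
  apply: cvgM; first exact: cvg_cst.
  apply: cvgB; first (apply: cvgB; last exact: cvg_cst).
    exact: (differentiable_continuous (dK Ux)).
  apply: cvg_dotv; first exact: cvg_cst.
  by apply: cvgB => //; exact: cvg_cst.
have /lte_between[c /andP[ac cJ]] : (a%:E - (ref_smooth w x)%:E < J x)%E.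
  by rewrite lteBlDr.
have [W xW Wc] := Jlsc cJ.
have gx : a - c < ref_smooth w x by move: ac; rewrite -EFinB lte_fin; lra.
exists (W `&` [set y | a - c < ref_smooth w y]).
  by apply: filterI => //; exact: (cvgr_gt _ cg).
move=> y [Wy /= gy] Uy; rewrite ref_subobjE -lteBlDr //.
by apply: lt_trans (Wc y Wy); rewrite -EFinB lte_fin; lra.
Qed.

(** Existence of a minimizer guarantees that [argmin] does not return its default value. *)
Lemma ref_primal_min w : [/\ U (T w), (J (T w) < +oo)%E &
  forall v, U v ->
    (J (T w) + (ref_smooth w (T w))%:E <= J v + (ref_smooth w v)%:E)%E].
Proof.
have s0 : 0 < beta / eps by rewrite divr_gt0 // Ksc.1.
have [x Ux Jx] := Jdom.
have phix : exists2 u, U u & (ref_subobj A b G Jb K gamma eps w u < +oo)%E.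
  by exists x => //; rewrite ref_subobjE lte_add_pinfty // ltry.
have phiN u : ref_subobj A b G Jb K gamma eps w u != -oo%E.
  by rewrite ref_subobjE adde_eq_ninfty negb_or sum_blocks_neqNy.
have [u Uu umin] := strongly_econvex_min clU cvU s0 phiN
  (@ref_subobj_lsc w) (@ref_subobj_strongly_econvex w) phix.
have [UT Tmin] : minimizers U (ref_subobj A b G Jb K gamma eps w) (T w).
  by apply: (@xgetPex _ 0 (minimizers _ _)); exists u.
split=> //; last by move=> v /Tmin; rewrite !ref_subobjE.
have := Tmin x Ux; rewrite !ref_subobjE -leeBrDr // => /le_lt_trans; apply.
by rewrite !lte_add_pinfty // ltry.
Qed.

Lemma ref_primal_uniq w v : U v ->
  (J v + (ref_smooth w v)%:E <= J (T w) + (ref_smooth w (T w))%:E)%E -> v = T w.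
Proof.
move=> Uv vT; have [UT JT Tmin] := ref_primal_min w.
have s0 : 0 < beta / eps by rewrite divr_gt0 // Ksc.1.
have Tv : (J (T w) + (ref_smooth w (T w))%:E = J v + (ref_smooth w v)%:E)%E.
  by apply/eqP; rewrite eq_le vT Tmin.
apply/esym; apply: (strongly_econvex_min_uniq s0 cvU
    (@ref_subobj_strongly_econvex w) UT Uv
    (a := \sum_i fine_block Jb i (T w) + ref_smooth w (T w))).
- by rewrite ref_subobjE (sum_blocks_fineE JN JT).
- by rewrite ref_subobjE -Tv (sum_blocks_fineE JN JT).
- by move=> x Ux; rewrite !ref_subobjE Tmin.
Qed.

(** [T w] is compared with [T w + t *: (u - T w)] as [t] tends to 0: convexity bounds the change of
    [J] linearly in [t], so that only [K] is differentiated. *)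
Lemma ref_primal_variational w u : U w.1 -> U u ->
  (J (T w) <= J u + (slope w (u - T w)
     + eps^-1 * dotv (grad K (T w) - grad K w.1) (u - T w))%:E)%E.
Proof.
move=> Uw Uu; have [UT JT Tmin] := ref_primal_min w.
have [|] := ltP (J u) +oo%E; last first.
  by rewrite leye_eq => /eqP ->; rewrite addye // leey.
move=> Ju; have := sum_blocks_fineE JN Ju; have := sum_blocks_fineE JN JT.
set a := \sum_i _; set c := \sum_i _; set d := u - T w => aE cE.
rewrite aE cE -EFinD lee_fin.
have e0 : 0 < eps^-1 by rewrite invr_gt0.
suff : eps * (a - c - slope w d) + dotv (grad K w.1) d <= dotv (grad K (T w)) d.
  rewrite dotvDl dotvNl -lerBrDr -ler_pdivlMl //.
  by rewrite mulrBr; lra.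
apply: grad_dir_ge => [|t /andP[t0 t1]]; first exact: dK.
have tI : 0 <= t <= 1 by rewrite (ltW t0).
have Uz : U (T w + t *: d) by rewrite add_scale_subE; exact: (convex_setP cvU).
have Jz : (J (T w + t *: d) <= (t * c + (1 - t) * a)%:E)%E.
  rewrite add_scale_subE.
  by apply: (convex_efunction_epi Jcv) => //; rewrite ?aE ?cE.
have := le_trans (Tmin _ Uz) (leeD2r _ Jz); rewrite aE -!EFinD lee_fin.
rewrite /ref_smooth slopeD slopeZ => H.
have : D (T w) w.1 - D (T w + t *: d) w.1 <= eps * (t * (c - a + slope w d)).
  rewrite -ler_pdivrMl // mulrBr.
  by move: H; lra.
rewrite /bregman !dotv_lin; lra.
Qed.

(** * The RPDC step as a single-block update *)

Definition block_value i w v : \bar R :=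
  (Jb (submxcol v i) + (dotv (submxcol (grad G w.1) i) (submxcol v i)
    + dotv (q w) (submxrow A i *m submxcol v i)
    + eps^-1 * D (update_block w.1 i v) w.1)%:E)%E.

Lemma rpdc_subobjE i w v : U w.1 -> U v ->
  rpdc_subobj A b G Jb K gamma eps i w v =
    (block_value i w v + (eps^-1 * D (update_block v i w.1) w.1)%:E)%E.
Proof.
move=> Uw Uv; rewrite /rpdc_subobj /block_value (addeC _ (Jb _)) -!addeA.
rewrite -!EFinD (bregman_update_split KE dK cvU i Uw Uw Uv) mulrDr.
by congr (_ + _%:E)%E; rewrite !addrA.
Qed.

(** Replacing block [i] of [T w] by that of [v] changes the reference objective by the change of
    [block_value], so minimality and uniqueness of [T w] pass to its block. *)
Lemma block_value_min i w v : U w.1 -> U v ->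
  (block_value i w (T w) <= block_value i w v)%E /\
  ((block_value i w v <= block_value i w (T w))%E -> submxcol v i = submxcol (T w) i).
Proof.
move=> Uw Uv; have [UT JT Tmin] := ref_primal_min w.
set v' := update_block (T w) i v.
have Uv' : U v' by exact: prod_blocks_update.
pose r := \sum_(j | j != i) fine_block Jb j (T w).
have rE : (r%:E = \sum_(j | j != i) Jb (submxcol (T w) j))%E.
  by rewrite -EFin_sum_fine // => j _; exact: block_fin_num.
have JTE : J (T w) = (Jb (submxcol (T w) i) + r%:E)%E.
  by rewrite /sum_blocks (bigD1 i) //= rE.
have JvE : J v' = (Jb (submxcol v i) + r%:E)%E.
  rewrite /sum_blocks (bigD1 i) //= submxcol_update eqxx rE; congr (_ + _)%E.
  by apply: eq_bigr => j /negPf ji; rewrite submxcol_update ji.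
(* [k] is the contribution of the blocks other than [i], on which [T w] and [v'] agree; hence the
   same constant serves in [TE] and [vE]. *)
pose k := r + ref_smooth w (T w) - (dotv (submxcol (grad G w.1) i) (submxcol (T w) i)
    + dotv (q w) (submxrow A i *m submxcol (T w) i)
    + eps^-1 * D (update_block w.1 i (T w)) w.1).
have TE : (J (T w) + (ref_smooth w (T w))%:E = block_value i w (T w) + k%:E)%E.
  rewrite JTE /block_value -!addeA -!EFinD; congr (_ + _%:E)%E.
  by rewrite /k; ring.
have vE : (J v' + (ref_smooth w v')%:E = block_value i w v + k%:E)%E.
  rewrite JvE /block_value -!addeA -!EFinD; congr (_ + _%:E)%E.
  have DT := bregman_update_split KE dK cvU i Uw Uw UT.
  have Dv := bregman_update_split KE dK cvU i Uw Uw Uv'.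
  have e1 : update_block w.1 i v' = update_block w.1 i v.
    apply/mxcolP => j; rewrite !submxcol_update; case: eqP => // ->.
    by rewrite submxcol_update eqxx.
  have e2 : update_block v' i w.1 = update_block (T w) i w.1.
    apply/mxcolP => j; rewrite !submxcol_update; case: eqP => // /eqP/negPf ji.
    by rewrite submxcol_update ji.
  have sv : slope w v' - slope w (T w) = dotv (submxcol (grad G w.1) i) (submxcol v i)
      - dotv (submxcol (grad G w.1) i) (submxcol (T w) i)
      + (dotv (q w) (submxrow A i *m submxcol v i)
      - dotv (q w) (submxrow A i *m submxcol (T w) i)).
    rewrite -slopeB /slope dotv_update_sub mulmx_update_sub.
    by rewrite submxcol_sub mulmxBr !dotvDr !dotvNr.
  by move: sv; rewrite /k /ref_smooth Dv e1 e2 DT; lra.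
split; first by have := Tmin v' Uv'; rewrite TE vE leeD2rE.
move=> vT; have v'T : v' = T w.
  by apply: ref_primal_uniq => //; rewrite TE vE leeD2rE.
by rewrite -[in RHS]v'T submxcol_update eqxx.
Qed.

(** Block [i] is best chosen as in [T w], and moving the other blocks only adds a Bregman term. That
    term is positive unless they stay put, by strong convexity, so the minimizer is unique and
    [argmin] must return it. *)
Lemma rpdc_stepE i w : U w.1 -> (step i w).1 = update_block w.1 i (T w).
Proof.
move=> Uw; have [UT JT Tmin] := ref_primal_min w.
set z := update_block w.1 i (T w).
have Uz : U z by exact: prod_blocks_update.
have upd_idem x y : update_block x i (update_block x i y) = update_block x i y.
  apply/mxcolP => j; rewrite !submxcol_update; case: eqP => // ->.
  by rewrite submxcol_update eqxx.
have upd_back x y : update_block (update_block x i y) i x = x.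
  by apply/mxcolP => j; rewrite !submxcol_update; case: eqP => // /eqP/negPf ji;
    rewrite submxcol_update ji.
have e0 : 0 < eps^-1 by rewrite invr_gt0.
have D0 : D w.1 w.1 = 0 by rewrite /bregman !subrr dotv0r subr0.
have zE : rpdc_subobj A b G Jb K gamma eps i w z = block_value i w (T w).
  rewrite rpdc_subobjE // upd_back D0 mulr0 adde0 /block_value upd_idem.
  by rewrite submxcol_update eqxx.
have Dge v : U v -> beta / 2 * enorm (v - w.1) ^+ 2 <= D v w.1.
  by move=> Uv; apply: (bregman_ge Ksc) => //; exact: dK.
have D_ge0 v : U v -> 0 <= D v w.1.
  move=> Uv; apply: le_trans (Dge v Uv).
  by rewrite mulr_ge0 ?sqr_ge0 // divr_ge0 // ltW // Ksc.1.
have zmin v : U v -> (block_value i w (T w) <= rpdc_subobj A b G Jb K gamma eps i w v)%E.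
  move=> Uv; rewrite rpdc_subobjE //.
  apply: le_trans (block_value_min i Uw Uv).1 _; apply: leeDl.
  rewrite lee_fin mulr_ge0 ?(ltW e0) // D_ge0 //; exact: prod_blocks_update.
apply: xget_unique => [|v [Uv vmin]].
  by split=> // v Uv; rewrite zE; exact: zmin.
have Uvw : U (update_block v i w.1) by exact: prod_blocks_update.
have := vmin z Uz; rewrite zE rpdc_subobjE // => vT.
have Tv := (block_value_min i Uw Uv).1.
have hfin : block_value i w (T w) \is a fin_num.
  by rewrite fin_numD block_fin_num.
have vfin : block_value i w v \is a fin_num.
  have vlt : (block_value i w v < +oo)%E.
    apply: le_lt_trans (_ : _ <= block_value i w (T w))%E _; last by rewrite ltey_eq hfin.
    apply: le_trans vT; apply: leeDl.
    by rewrite lee_fin mulr_ge0 ?(ltW e0) // D_ge0.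
  rewrite fin_numE -ltey vlt andbT -ltNye; apply: lt_le_trans Tv.
  by rewrite ltNye_eq hfin.
move: vT Tv (block_value_min i Uw Uv).2.
rewrite -(fineK hfin) -(fineK vfin) -EFinD !lee_fin => vT Tv veq.
have D0' : eps^-1 * D (update_block v i w.1) w.1 = 0.
  apply/eqP; rewrite eq_le; apply/andP; split; first by move: vT Tv; lra.
  by rewrite mulr_ge0 ?(ltW e0) // D_ge0.
have vi : submxcol v i = submxcol (T w) i by apply: veq; move: vT; rewrite D0' addr0.
have vw : update_block v i w.1 = w.1.
  apply/eqP; rewrite -subr_eq0 -enorm_eq0 -sqrf_eq0 eq_le sqr_ge0 andbT.
  have := Dge _ Uvw; move/eqP: D0'; rewrite mulf_eq0 gt_eqF //= => /eqP ->.
  by rewrite pmulr_rle0 // divr_gt0 // Ksc.1.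
apply/mxcolP => j; rewrite submxcol_update; case: eqP => [->//|/eqP/negPf ji].
by rewrite -[in RHS]vw submxcol_update ji.
Qed.

(** * The Lyapunov function and its expected decrease *)

Context (BG : R) (xs : V) (ps : 'cV[R]_m).
Local Notation lam := (lambda_max (A^T *m A)).
Local Notation res u := (A *m u - b).
Context (gamma_gt0 : 0 < gamma) (rho_gt0 : 0 < rho) (N_gt0 : (0 < N)%N).
Context (Gcv : convex_function setT G) (dG : forall u, differentiable G u).
Context (Glip : elipschitz setT BG (grad G)).

Definition fine_objective u : R := G u + \sum_j fine_block Jb j u.
Local Notation F := fine_objective.

Definition lyapunov w : R :=
  N%:R / eps * D xs w.1 + dotv (w.2 - ps) (w.2 - ps) / (2 * rho)
  + (N%:R - 1) * (F w.1 - F xs + dotv w.2 (res w.1)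
                  + gamma / 2 * dotv (res w.1) (res w.1))
  - gamma / 2 * dotv (res w.1) (res w.1).

(** The proximal term contributes [beta / eps / 2]; the upper curvature of the smooth part, from
    [BG] for [G] and [gamma * lam] for the penalty, is paid out of it. *)
Definition primal_rate : R := (beta / eps - BG - gamma * lam) / 2.
(** The dual step costs [rho / 2] in the distance to [ps] and [(N - 1) * rho] in the augmented gap,
    both times the squared new residual; together this is [(2 * N - 1) * rho / 2]. *)
Definition dual_rate : R := gamma - (2 * N%:R - 1) * rho / 2.

Definition decrement w : R :=
  primal_rate * dotv (T w - w.1) (T w - w.1)
  + dual_rate / N%:R * \sum_i dotv (res (step i w).1) (res (step i w).1).

Context (primal_rate_gt0 : 0 < primal_rate) (dual_rate_gt0 : 0 < dual_rate).
Context (Uxs : U xs) (Jxs : (J xs < +oo)%E) (Axs : A *m xs = b).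
Context (xs_min : forall u, U u -> (J u < +oo)%E ->
  F xs <= F u + dotv ps (res u)).

Lemma resE u : res u = A *m (u - xs).
Proof. by rewrite mulmxBr Axs. Qed.

Lemma dotv_res_le u v : dotv (A *m (u - v)) (A *m (u - v)) <= lam * dotv (u - v) (u - v).
Proof. exact: dotv_mulmx_le. Qed.

(** In dimension zero the Lipschitz condition does not force [BG >= 0], hence the product form. *)
Lemma lipschitz_dotvv_ge0 u v : 0 <= BG * dotv (u - v) (u - v).
Proof.
rewrite -sqr_enorm expr2 mulrA mulr_ge0 ?enorm_ge0 //.
exact: le_trans (enorm_ge0 _) (Glip I I).
Qed.

Lemma natrN_ge1 : 1 <= N%:R :> R. Proof. by rewrite ler1n. Qed.

(** The Bregman term absorbs the negative penalty ([part1]). By the saddle inequality and Young, the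
    augmented gap is at least [- Y / (2 * gamma)]; the bound on [rho] makes [Y / (2 * rho)] cover
    [N - 1] such losses with [Y / (4 * gamma)] to spare ([part2]). *)
Lemma lyapunov_ge w : U w.1 -> (J w.1 < +oo)%E ->
  primal_rate * dotv (w.1 - xs) (w.1 - xs)
    + dotv (w.2 - ps) (w.2 - ps) / (4 * gamma) <= lyapunov w.
Proof.
move=> Uw Jw; rewrite /lyapunov.
set r := res w.1; set y := w.2 - ps; set n1 : R := N%:R.
have n11 : 1 <= n1 by exact: natrN_ge1.
have l0 := xs_min Uw Jw; rewrite -/r in l0.
have wy : dotv w.2 r = dotv y r + dotv ps r by rewrite -dotvDl subrK.
have young : - dotv y y / (2 * gamma) <= dotv y r + gamma / 2 * dotv r r.
  have := dotv_young (- y) r (a := gamma^-1) _; rewrite invr_gt0 => /(_ gamma_gt0).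
  rewrite invrK !dotvNl dotvNr opprK => H.
  have -> : - dotv y y / (2 * gamma) = - (gamma^-1 * dotv y y) / 2.
    by field; rewrite gt_eqF.
  by move: H; lra.
have rr : dotv r r <= lam * dotv (w.1 - xs) (w.1 - xs).
  by rewrite /r resE dotv_res_le.
have Dge : beta / 2 * dotv (w.1 - xs) (w.1 - xs) <= D xs w.1.
  rewrite -sqr_enorm -enormN opprB.
  by apply: (bregman_ge Ksc) => //; exact: dK.
have BG0 := lipschitz_dotvv_ge0 w.1 xs.
have e0 : 0 < eps^-1 by rewrite invr_gt0.
set X := dotv (w.1 - xs) (w.1 - xs) in rr Dge BG0 *.
have X0 : 0 <= X by exact: dotvv_ge0.
set Y := dotv y y in young *; have Y0 : 0 <= Y by exact: dotvv_ge0.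
have part1 : primal_rate * X <= n1 / eps * D xs w.1 - gamma / 2 * dotv r r.
  have D1 : n1 / eps * (beta / 2 * X) <= n1 / eps * D xs w.1.
    by rewrite ler_wpM2l // divr_ge0 ?(ltW eps_gt0) // (le_trans ler01).
  have D2 : beta / eps / 2 * X <= n1 / eps * (beta / 2 * X).
    have -> : n1 / eps * (beta / 2 * X) = n1 * (beta / eps / 2 * X) by ring.
    rewrite ler_peMl // mulr_ge0 // !divr_ge0 // ltW //; exact: Ksc.1.
  have D3 : gamma / 2 * dotv r r <= gamma / 2 * (lam * X).
    by rewrite ler_wpM2l // divr_ge0 // ltW.
  rewrite /primal_rate; lra.
have part2 : Y / (4 * gamma) <= Y / (2 * rho)
   + (n1 - 1) * (F w.1 - F xs + dotv w.2 r + gamma / 2 * dotv r r).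
  have h1 : (n1 - 1) * (- Y / (2 * gamma)) <=
      (n1 - 1) * (F w.1 - F xs + dotv w.2 r + gamma / 2 * dotv r r).
    by apply: ler_wpM2l; [rewrite subr_ge0|rewrite wy; lra].
  have h2 : (2 * n1 - 1) / (4 * gamma) * Y <= Y / (2 * rho).
    rewrite [leLHS]mulrC ler_wpM2l // ler_pdivrMr ?mulr_gt0 //.
    rewrite [leRHS]mulrC ler_pdivlMr ?mulr_gt0 //.
    by move: dual_rate_gt0; rewrite /dual_rate -/n1; lra.
  have h3 : Y / (4 * gamma) = (2 * n1 - 1) / (4 * gamma) * Y + (n1 - 1) * (- Y / (2 * gamma)).
    by field; rewrite gt_eqF.
  lra.
lra.
Qed.

(* The increments of D and of the augmented Lagrangian, weighted by N, are
   controlled only after summation over i. *)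
Lemma lyapunov_step_le i w : U w.1 -> (J w.1 < +oo)%E ->
  let u' := (step i w).1 in
  lyapunov (step i w) + dual_rate * dotv (res u') (res u') <=
    lyapunov w + (F w.1 - F xs + dotv w.2 (res w.1) + gamma * dotv (res w.1) (res w.1))
    + N%:R * (eps^-1 * (D xs u' - D xs w.1)
       + (F u' - F w.1 + dotv w.2 (res u' - res w.1)
          + gamma / 2 * (dotv (res u') (res u') - dotv (res w.1) (res w.1)))).
Proof.
move=> Uw Jw /=.
have [UT JT _] := ref_primal_min w.
have Uu' : U (step i w).1 by rewrite rpdc_stepE //; exact: prod_blocks_update.
have Ju' : (J (step i w).1 < +oo)%E.
  rewrite rpdc_stepE //; apply/(sum_blocks_ltyP JN) => j.
  by rewrite submxcol_update; case: eqP => _; exact: (sum_blocks_ltyP JN _).1.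
have l0 := xs_min Uu' Ju'.
have p'E : (step i w).2 = w.2 + rho *: res (step i w).1 by [].
rewrite /lyapunov p'E; set u' := (step i w).1 in l0 *.
set r' := res u' in l0 *; set r := res w.1.
have -> : w.2 + rho *: r' - ps = w.2 - ps + rho *: r' by rewrite addrAC.
set y := w.2 - ps.
have wr : dotv ps r' = dotv w.2 r' - dotv y r' by rewrite -dotvNl -dotvDl opprB addrC subrK.
have rho2 : dotv (y + rho *: r') (y + rho *: r') / (2 * rho)
    = dotv y y / (2 * rho) + dotv y r' + rho / 2 * dotv r' r'.
  by rewrite dotv_sqrD; field; rewrite gt_eqF.
rewrite rho2 /dual_rate (dotvDl w.2 (rho *: r') r') (dotvZl rho r' r').
rewrite (dotvDr w.2 r' (- r)) (dotvNr w.2 r).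
rewrite wr in l0; lra.
Qed.

Lemma sum_slope_update w u : \sum_i slope w (update_block w.1 i u - w.1) = slope w (u - w.1).
Proof.
rewrite /slope big_split /= sum_dotv_update; congr (_ + _).
rewrite -[RHS]dotvC dotv_trmx dotvC -sum_dotv_update.
by apply: eq_bigr => i _; rewrite dotvC dotv_trmx dotvC.
Qed.

(** Each increment is bounded by its linearization at [w.1] plus a curvature term. The sum over [i]
    is then the increment towards [T w], to which the variational inequality at [xs] applies. *)
Lemma sum_increments_le w : U w.1 -> (J w.1 < +oo)%E ->
  \sum_i (eps^-1 * (D xs (step i w).1 - D xs w.1)
       + (F (step i w).1 - F w.1 + dotv w.2 (res (step i w).1 - res w.1)
          + gamma / 2 * (dotv (res (step i w).1) (res (step i w).1)
                         - dotv (res w.1) (res w.1))))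
  <= - (F w.1 - F xs + dotv w.2 (res w.1) + gamma * dotv (res w.1) (res w.1))
     - primal_rate * dotv (T w - w.1) (T w - w.1).
Proof.
move=> Uw Jw; have [UT JT _] := ref_primal_min w.
pose z i := update_block w.1 i (T w).
have zE i : (step i w).1 = z i by exact: rpdc_stepE.
pose Jf u := \sum_j fine_block Jb j u.
have Yle i : F (z i) - F w.1 + dotv w.2 (res (z i) - res w.1)
     + gamma / 2 * (dotv (res (z i)) (res (z i)) - dotv (res w.1) (res w.1))
   <= slope w (z i - w.1) + (Jf (z i) - Jf w.1)
      + (BG + gamma * lam) / 2 * dotv (z i - w.1) (z i - w.1).
  have Gle := descent_lemma w.1 (z i) Gcv dG Glip.
  rewrite sqr_enorm in Gle.
  have Ale := dotv_res_le (z i) w.1.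
  have {}Ale : gamma / 2 * dotv (A *m (z i - w.1)) (A *m (z i - w.1)) <=
      gamma / 2 * (lam * dotv (z i - w.1) (z i - w.1)).
    by rewrite ler_wpM2l // divr_ge0 // ltW.
  have rE : res (z i) = res w.1 + A *m (z i - w.1).
    by rewrite mulmxBr [RHS]addrC [RHS]addrA subrK.
  rewrite rE; set h := A *m _ in Ale *; set r := res w.1.
  have -> : r + h - r = h by rewrite addrAC subrr add0r.
  rewrite /F -/(Jf _) -/(Jf _) /slope /qmult -/r -/h.
  have := dotv_sqrD 1 r h; rewrite scale1r => ->.
  rewrite (dotvDl w.2 (gamma *: r) h) (dotvZl gamma r h).
  by move: Gle Ale; rewrite /Jf; lra.
apply: (@le_trans _ _ (\sum_i (eps^-1 * (D xs (z i) - D xs w.1)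
   + (slope w (z i - w.1) + (Jf (z i) - Jf w.1)
      + (BG + gamma * lam) / 2 * dotv (z i - w.1) (z i - w.1))))).
  by apply: ler_sum => i _; rewrite !zE lerD2l.
have split4 (f g h k : 'I_N -> R) (a c : R) :
    \sum_i (a * f i + (g i + h i + c * k i)) =
      a * \sum_i f i + (\sum_i g i + \sum_i h i + c * \sum_i k i).
  by rewrite !big_split /= -!mulr_sumr.
rewrite (split4 (fun i => D xs (z i) - D xs w.1) (fun i => slope w (z i - w.1))
  (fun i => Jf (z i) - Jf w.1) (fun i => dotv (z i - w.1) (z i - w.1))).
have sD : \sum_i (D xs (z i) - D xs w.1) = D xs (T w) - D xs w.1.
  exact: (sum_bregman_update KE dK cvU).
have sS : \sum_i slope w (z i - w.1) = slope w (T w - w.1).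
  exact: sum_slope_update.
have sX : \sum_i dotv (z i - w.1) (z i - w.1) = dotv (T w - w.1) (T w - w.1).
  exact: sum_dotvv_update.
rewrite sD sS sX.
have -> : \sum_i (Jf (z i) - Jf w.1) = Jf (T w) - Jf w.1.
  apply: (sum_separable_update (f := fun j => fine_block Jb j)) => i j.
  by rewrite /fine_block submxcol_update.
have := ref_primal_variational Uw Uxs.
rewrite (sum_blocks_fineE JN JT) (sum_blocks_fineE JN Jxs) -EFinD lee_fin -/(Jf _) -/(Jf _).
(* The three-point identity of Bregman distances; the two involving [xs] cancel the summed increment
   of [D], and the third supplies the proximal gain. *)
have -> : dotv (grad K (T w) - grad K w.1) (xs - T w)
    = D xs w.1 - D xs (T w) - D (T w) w.1.
  by rewrite /bregman !dotv_lin; ring.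
have Dge : beta / eps / 2 * dotv (T w - w.1) (T w - w.1) <= eps^-1 * D (T w) w.1.
  have -> : beta / eps / 2 * dotv (T w - w.1) (T w - w.1) =
    eps^-1 * (beta / 2 * dotv (T w - w.1) (T w - w.1)) by ring.
  rewrite ler_pM2l ?invr_gt0 // -sqr_enorm.
  by apply: (bregman_ge Ksc) => //; exact: dK.
have Gle := convex_grad xs Gcv (dG w.1).
have sE : slope w (xs - T w) = slope w (xs - w.1) - slope w (T w - w.1).
  by rewrite !slopeB; ring.
(* As [A *m (xs - w.1)] is minus the residual, pairing it with [q w] yields the full [gamma], not
   [gamma / 2]. *)
have sxs : slope w (xs - w.1) = dotv (grad G w.1) (xs - w.1)
    - (dotv w.2 (res w.1) + gamma * dotv (res w.1) (res w.1)).
  rewrite /slope /qmult -[xs - w.1]opprB mulmxN -resE !dotvNr dotvDl dotvZl.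
  by ring.
rewrite sE sxs /F -/(Jf _) -/(Jf _) /primal_rate; lra.
Qed.

Lemma lyapunov_descent w : U w.1 -> (J w.1 < +oo)%E ->
  \sum_i lyapunov (step i w) <= N%:R * (lyapunov w - decrement w).
Proof.
move=> Uw Jw.
have sum_le (f g h : 'I_N -> R) (a d : R) :
    (forall i, f i + d * g i <= a + N%:R * h i) ->
    \sum_i f i + d * \sum_i g i <= N%:R * (a + \sum_i h i).
  move=> le; have := ler_sum (index_enum _) (fun i (_ : true) => le i).
  rewrite !big_split /= -!mulr_sumr sumr_const card_ord -[a *+ _]mulr_natl mulrDr.
  exact.
have n0 : 0 < N%:R :> R by rewrite ltr0n.
apply: le_trans (_ : N%:R * (lyapunov w - primal_rate * dotv (T w - w.1) (T w - w.1))
  - dual_rate * \sum_i dotv (res (step i w).1) (res (step i w).1) <= _).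
  rewrite lerBrDr; apply: le_trans (sum_le _ _ _ _ _ (fun i => lyapunov_step_le i Uw Jw)) _.
  rewrite ler_pM2l // -addrA lerD2l -lerBrDl.
  by apply: le_trans (sum_increments_le Uw Jw) _; rewrite addrC.
rewrite /decrement opprD addrA [leRHS]mulrBr lerD2l lerN2 mulrA.
by rewrite [N%:R * _]mulrC divfK ?gt_eqF.
Qed.

Lemma sqr_residualE w : pair_norm (w - ref_point A b Ub G Jb K gamma eps w) ^+ 2
  = dotv (T w - w.1) (T w - w.1) + gamma ^+ 2 * dotv (res (T w)) (res (T w)).
Proof.
rewrite sqr_enorm dotvE tr_col_mx mul_row_col mxE -!dotvE /=.
rewrite -/(T w) -(opprB (T w)) dotvNl dotvNr opprK; congr (_ + _).
by rewrite opprD addrA subrr add0r dotvNl dotvNr opprK dotvZl dotvZr mulrA expr2.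
Qed.

(** The decrement sees the constraint residual only at the partial updates. Each of these differs
    from [T w] by at most [T w - w.1] in norm, so the residual at [T w] is recovered from |a + b|^2
    <= 2 |a|^2 + 2 |b|^2, averaged over [i]. *)
Lemma residual_le w : U w.1 ->
  pair_norm (w - ref_point A b Ub G Jb K gamma eps w) ^+ 2 <=
   (primal_rate^-1 + gamma ^+ 2 * (2 / dual_rate + 2 * `|lam| / primal_rate))
     * decrement w.
Proof.
move=> Uw; have n0 : 0 < N%:R :> R by rewrite ltr0n.
set X := dotv (T w - w.1) (T w - w.1).
set S := \sum_i dotv (res (step i w).1) (res (step i w).1).
have X0 : 0 <= X by exact: dotvv_ge0.
have S0 : 0 <= S by apply: sumr_ge0 => i _; exact: dotvv_ge0.
rewrite sqr_residualE -/X.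
have XD : primal_rate * X <= decrement w.
  by rewrite /decrement lerDl mulr_ge0 // divr_ge0 // ltW.
have SD : dual_rate / N%:R * S <= decrement w.
  by rewrite /decrement lerDr mulr_ge0 // ltW.
have rT : dotv (res (T w)) (res (T w)) <= 2 * (S / N%:R) + 2 * (`|lam| * X).
  have each i : dotv (res (T w)) (res (T w)) <=
      2 * dotv (res (step i w).1) (res (step i w).1) + 2 * (`|lam| * X).
    rewrite rpdc_stepE //; set z := update_block _ _ _.
    have zX : dotv (T w - z) (T w - z) <= X.
      rewrite /X dotv_blocks [leRHS]dotv_blocks; apply: ler_sum => j _.
      rewrite !submxcol_sub submxcol_update; case: eqP => // _.
      by rewrite subrr dotv0l dotvv_ge0.
    have Az := dotv_res_le (T w) z.
    have {}Az : dotv (A *m (T w - z)) (A *m (T w - z)) <= `|lam| * X.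
      apply: le_trans Az _; apply: le_trans (_ : `|lam| * dotv (T w - z) (T w - z) <= _).
        by rewrite ler_wpM2r ?dotvv_ge0 // ler_norm.
      by rewrite ler_wpM2l.
    have -> : res (T w) = res z + A *m (T w - z) by rewrite mulmxBr [RHS]addrC [RHS]addrA subrK.
    set h := A *m (T w - z) in Az *; set r := res z.
    have := dotvv_ge0 (r + (-1) *: h); have := dotv_sqrD 1 r h.
    by rewrite scale1r dotv_sqrD => ->; lra.
  rewrite -(ler_pM2l n0).
  have -> : N%:R * dotv (res (T w)) (res (T w)) = \sum_(i < N) dotv (res (T w)) (res (T w)).
    by rewrite sumr_const card_ord mulr_natl.
  apply: le_trans (ler_sum _ (fun i _ => each i)) _.
  rewrite big_split /= -mulr_sumr sumr_const card_ord -[X in _ + X]mulr_natl -/S.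
  by rewrite le_eqVlt; apply/orP; left; apply/eqP; field; rewrite gt_eqF.
have {}XD : X <= primal_rate^-1 * decrement w by rewrite ler_pdivlMl.
have {}SD : S / N%:R <= dual_rate^-1 * decrement w.
  by rewrite ler_pdivlMl //; move: SD; rewrite mulrAC mulrA.
have lX := ler_wpM2l (normr_ge0 lam) XD.
have g0 : 0 <= gamma ^+ 2 by exact: sqr_ge0.
have := ler_wpM2l g0 rT; have := ler_wpM2l g0 lX; have := ler_wpM2l g0 SD.
by lra.
Qed.

Lemma decrement_ge0 w : 0 <= decrement w.
Proof.
apply: addr_ge0; apply: mulr_ge0; rewrite ?dotvv_ge0 ?(ltW primal_rate_gt0) //.
  by rewrite divr_ge0 // ltW.
by apply: sumr_ge0 => i _; exact: dotvv_ge0.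
Qed.

(** * Saddle points and passage to the limit *)

Local Notation L := (lagrangian A b G Jb).

Lemma lagrangianE u p : (J u < +oo)%E -> L u p = (F u + dotv p (res u))%:E.
Proof. by move=> Ju; rewrite /lagrangian /objective (sum_blocks_fineE JN Ju) -!EFinD. Qed.

Lemma lagrangian_ltyP u p : (L u p < +oo)%E -> (J u < +oo)%E.
Proof.
apply: contraTT; rewrite -!leNgt !leye_eq => /eqP Jy.
by rewrite /lagrangian /objective Jy addey.
Qed.

Lemma saddle_pointP x p : saddle_point U L (x, p) ->
  [/\ U x, (J x < +oo)%E, A *m x = b &
      forall u, U u -> (J u < +oo)%E -> F x <= F u + dotv p (res u)].
Proof.
move=> [/= Ux Lp Lu]; have [x0 Ux0 Jx0] := Jdom.
have Jx : (J x < +oo)%E.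
  apply: (@lagrangian_ltyP x p); apply: le_lt_trans (Lu _ Ux0) _.
  by rewrite lagrangianE // ltry.
have rx : res x = 0.
  (* The multiplier shifted by the residual itself turns the left saddle inequality into |r(x)|^2 <=
     0. *)
  have := Lp (p + res x); rewrite !lagrangianE // lee_fin dotvDl => H.
  by apply/eqP; rewrite -dotvv_eq0 eq_le dotvv_ge0 andbT; move: H; lra.
split=> // [|u Uu Ju]; first by apply/eqP; rewrite -subr_eq0 rx.
by have := Lu u Uu; rewrite !lagrangianE // lee_fin rx dotv0r addr0.
Qed.

Lemma cvg_grad (C : set V) (M : R) (g : V -> R) (X : Type) (H : set_system X)
    {HH : Filter H} (f h : X -> V) :
  elipschitz C M (grad g) -> (\forall t \near H, C (f t)) -> (\forall t \near H, C (h t)) ->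
  (fun t => enorm (f t - h t)) @ H --> (0 : R) ->
  (fun t => enorm (grad g (f t) - grad g (h t))) @ H --> (0 : R).
Proof.
move=> gl Cf Ch fh.
have Mfh : (fun t => M * enorm (f t - h t)) @ H --> (0 : R).
  by rewrite -(mulr0 M); apply: cvgM => //; exact: cvg_cst.
apply: (squeeze_cvgr _ (@cvg_cst _ (0 : R) _ H _) Mfh).
by apply: filterS2 Cf Ch => t Ct Dt; rewrite enorm_ge0 /=; exact: gl.
Qed.

(** Stated for filters, because a cluster point is the limit of a finer filter. A vanishing distance
    to the reference point forces [T w] to the same limit and its residual to 0; the variational
    inequality then passes to the limit. *)
Lemma ref_point_cvg_saddle (B : R) (Fl : set_system (V * 'cV[R]_m))
    {FF : ProperFilter Fl} w' :
  elipschitz U B (grad K) -> Fl --> w' -> (\forall w \near Fl, U w.1) ->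
  (fun w => pair_norm (w - ref_point A b Ub G Jb K gamma eps w)) @ Fl --> (0 : R) ->
  saddle_point U L w'.
Proof.
move=> Klip Fw FU Fres.
have cu : (fun w => w.1) @ Fl --> w'.1 by apply: cvg_comp Fw _; exact: cvg_fst.
have cp : (fun w => w.2) @ Fl --> w'.2 by apply: cvg_comp Fw _; exact: cvg_snd.
have Tle w : enorm (T w - w.1) <= pair_norm (w - ref_point A b Ub G Jb K gamma eps w).
  rewrite -(@ler_pXn2r _ 2) ?nnegrE ?enorm_ge0 // sqr_residualE sqr_enorm lerDl.
  by rewrite mulr_ge0 ?sqr_ge0 ?dotvv_ge0.
have rle w : enorm (res (T w)) <=
    gamma^-1 * pair_norm (w - ref_point A b Ub G Jb K gamma eps w).
  rewrite ler_pdivlMl // -(@ler_pXn2r _ 2) ?nnegrE ?mulr_ge0 ?enorm_ge0 ?(ltW gamma_gt0) //.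
  by rewrite sqr_residualE exprMn sqr_enorm lerDr dotvv_ge0.
have cTu : (fun w => enorm (T w - w.1)) @ Fl --> (0 : R).
  apply: (squeeze_cvgr _ (@cvg_cst _ (0 : R) _ Fl _) Fres).
  by apply: nearW => w; rewrite enorm_ge0 Tle.
have cT : (fun w => T w) @ Fl --> w'.1.
  rewrite -(add0r w'.1) (_ : (fun w => T w) = fun w => (T w - w.1) + w.1).
    by apply: cvgD => //; exact: cvg_enorm0.
  by apply/funext => w; rewrite subrK.
have cr : (fun w => res (T w)) @ Fl --> res w'.1.
  by apply: cvgB; [exact: cvg_mulmx|exact: cvg_cst].
have Aw' : res w'.1 = 0.
  have c0 : (fun w => res (T w)) @ Fl --> (0 : 'cV[R]_m).
    apply: cvg_enorm0.
    have cg : (fun w => gamma^-1 * pair_norm (w - ref_point A b Ub G Jb K gamma eps w))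
        @ Fl --> (0 : R).
      by rewrite -(mulr0 gamma^-1); apply: cvgM => //; exact: cvg_cst.
    apply: (squeeze_cvgr _ (@cvg_cst _ (0 : R) _ Fl _) cg).
    by apply: nearW => w; rewrite enorm_ge0 rle.
  exact: (cvg_unique _ cr c0).
have Uw' : U w'.1 by exact: (closed_cvg _ clU FU _ cu).
have cG : (fun w => grad G w.1) @ Fl --> grad G w'.1.
  rewrite -(add0r (grad G w'.1)).
  rewrite (_ : (fun w => _) = fun w => (grad G w.1 - grad G w'.1) + grad G w'.1); last first.
    by apply/funext => w; rewrite subrK.
  apply: cvgD; last exact: cvg_cst.
  apply: cvg_enorm0; apply: (cvg_grad Glip); [exact: nearW|exact: nearW|].
  rewrite -(@enorm0 R (\sum_i dim i)) -(subrr w'.1); apply: cvg_enorm.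
  by apply: cvgB => //; exact: cvg_cst.
have cK : (fun w => enorm (grad K (T w) - grad K w.1)) @ Fl --> (0 : R).
  apply: (cvg_grad Klip) => //.
  by apply: nearW => w; have [] := ref_primal_min w.
have cq : (fun w => q w) @ Fl --> w'.2.
  rewrite -[w'.2]addr0 -(scaler0 _ gamma) -Aw'; apply: cvgD => //.
  apply: cvgZ; first exact: cvg_cst.
  by apply: cvgB; [exact: cvg_mulmx|exact: cvg_cst].
have J_le u : U u -> (J u < +oo)%E ->
    (J w'.1 <= J u + (dotv (grad G w'.1) (u - w'.1) + dotv w'.2 (res u))%:E)%E.
  move=> Uu Ju; set c := dotv _ _ + _.
  pose f w := slope w (u - T w) + eps^-1 * dotv (grad K (T w) - grad K w.1) (u - T w).
  have cuT : (fun w => u - T w) @ Fl --> u - w'.1 by apply: cvgB => //; exact: cvg_cst.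
  have cf : f @ Fl --> c.
    rewrite -[c]addr0 -(mulr0 eps^-1); apply: cvgD.
      apply: cvgD; first exact: cvg_dotv.
      have -> : res u = A *m (u - w'.1).
        by rewrite mulmxBr -[LHS]subr0 -Aw' opprB addrA subrK.
      by apply: cvg_dotv => //; exact: cvg_mulmx.
    apply: cvgM; first exact: cvg_cst.
    rewrite -(dotv0l (u - w'.1)); apply: cvg_dotv => //; exact: cvg_enorm0.
  (* Lower semicontinuity suffices for [J]: a real [a] strictly between the two sides would be
     exceeded by [J (T w)] near the limit, against the variational inequality there. *)
  rewrite leNgt; apply/negP; rewrite (sum_blocks_fineE JN Ju) -EFinD.
  set j := \sum_i _ => /lte_between[a /andP[]]; rewrite lte_fin => ja aJ.
  have [W w'W Wa] := Jlsc aJ.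
  have aT : \forall w \near Fl, a <= j + f w.
    have FW : \forall w \near Fl, W (T w) by exact: cT.
    apply: filterS2 FW FU => w WT Uw.
    have := lt_le_trans (Wa _ WT) (ref_primal_variational Uw Uu).
    by rewrite (sum_blocks_fineE JN Ju) -EFinD lte_fin => /ltW.
  have cj : (fun w => j + f w) @ Fl --> j + c by apply: cvgD => //; exact: cvg_cst.
  have acj : a <= j + c by exact: (ler_limits (@cvg_cst _ a _ Fl _) cj aT).
  by have := lt_le_trans ja acj; rewrite ltxx.
have Jw' : (J w'.1 < +oo)%E.
  have [x Ux Jx] := Jdom; apply: le_lt_trans (J_le x Ux Jx) _.
  by rewrite lte_add_pinfty ?ltry.
split=> //= [p|u Uu]; first by rewrite !lagrangianE // Aw' !dotv0r.
have [Ju|Ju] := boolP (J u < +oo)%E; last first.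
  move: Ju; rewrite -leNgt leye_eq => /eqP Ju.
  by rewrite [leRHS]/lagrangian /objective Ju addey // addye // leey.
rewrite !lagrangianE // Aw' dotv0r addr0 lee_fin.
have := J_le u Uu Ju; rewrite (sum_blocks_fineE JN Ju) (sum_blocks_fineE JN Jw') -EFinD lee_fin.
have := convex_grad u Gcv (dG w'.1).
rewrite /F; lra.
Qed.

(** * The potential on the tree of draws *)

Context (u0 : V) (p0 : 'cV[R]_m) (Uu0 : U u0).

Definition state (s : seq 'I_N) : V * 'cV[R]_m := foldl (fun w i => step i w) (u0, p0) s.

Lemma state_rcons s i : state (rcons s i) = step i (state s).
Proof. by rewrite /state foldl_rcons. Qed.

Lemma state_feasible s : U (state s).1.
Proof.
elim/last_ind: s => [//|s i IH]; rewrite state_rcons rpdc_stepE //.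
by apply: prod_blocks_update => //; have [] := ref_primal_min (state s).
Qed.

(* J u0 = +oo is allowed: a block of J becomes finite only once it is drawn. *)
Lemma state_block_finite s i : i \in s -> (Jb (submxcol (state s).1 i) < +oo)%E.
Proof.
elim/last_ind: s => [//|s j IH]; rewrite mem_rcons inE state_rcons.
rewrite rpdc_stepE ?submxcol_update; last exact: state_feasible.
case: eqP => [_ _|_ /=]; last exact: IH.
by have [_ JT _] := ref_primal_min (state s); exact: (sum_blocks_ltyP JN _).1.
Qed.

Definition covers (s : seq 'I_N) : bool := [forall i, i \in s].

Lemma state_finite s : covers s -> (J (state s).1 < +oo)%E.
Proof.
by move=> /forallP cs; apply/(sum_blocks_ltyP JN) => i; exact: state_block_finite.
Qed.

Lemma covers_rcons s i : covers s -> covers (rcons s i).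
Proof. by move=> /forallP cs; apply/forallP => j; rewrite mem_rcons inE cs orbT. Qed.

(** Only prefixes that contain every index are counted: [lyapunov_descent] applies where [J] is
    finite, which [covers] guarantees. *)
Definition total_decrement (s : seq 'I_N) : R :=
  \sum_(0 <= j < size s | covers (take j s)) decrement (state (take j s)).

Definition potential (s : seq 'I_N) : R := lyapunov (state s) + total_decrement s.

Lemma total_decrement_ge0 s : 0 <= total_decrement s.
Proof. by apply: sumr_ge0 => j _; exact: decrement_ge0. Qed.

Lemma lyapunov_ge0 w : U w.1 -> (J w.1 < +oo)%E -> 0 <= lyapunov w.
Proof.
move=> Uw Jw; apply: le_trans (lyapunov_ge Uw Jw).
apply: addr_ge0; first by rewrite mulr_ge0 ?dotvv_ge0 // ltW.
by rewrite divr_ge0 ?dotvv_ge0 // mulr_ge0 // ltW.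
Qed.

Lemma potential_ge0 s : covers s -> 0 <= potential s.
Proof.
move=> cs; rewrite addr_ge0 ?total_decrement_ge0 // lyapunov_ge0 //.
  exact: state_feasible.
exact: state_finite.
Qed.

Lemma total_decrement_rcons s i : covers s ->
  total_decrement (rcons s i) = total_decrement s + decrement (state s).
Proof.
move=> cs; rewrite /total_decrement size_rcons big_mkcond big_nat_recr //=.
have tk j : (j <= size s)%N -> take j (rcons s i) = take j s.
  by move=> js; rewrite -cats1 takel_cat.
rewrite tk // take_size cs; congr (_ + _); rewrite [RHS]big_mkcond.
by apply: eq_big_nat => j /andP[_ js]; rewrite tk // ltnW.
Qed.

Lemma potential_super s : covers s ->
  \sum_i potential (rcons s i) <= N%:R * potential s.
Proof.
move=> cs.
have pE i : potential (rcons s i) =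
    lyapunov (step i (state s)) + (total_decrement s + decrement (state s)).
  by rewrite /potential state_rcons total_decrement_rcons.
rewrite (eq_bigr _ (fun i _ => pE i)) big_split /=.
rewrite sumr_const card_ord -[X in _ + X]mulr_natl.
have := lyapunov_descent (state_feasible s) (state_finite cs).
by rewrite /potential; lra.
Qed.

(** * Deterministic consequences of a bounded potential *)

Section Path.
Context (i_ : nat -> 'I_N).
Local Notation w k := (rpdc A b Ub G Jb K gamma eps rho (u0, p0) i_ k).
Local Notation path k := (mkseq i_ k).
Local Notation residual w := (pair_norm (w - ref_point A b Ub G Jb K gamma eps w)).

Lemma rpdc_state k : w k = state (path k).
Proof. by elim: k => [//|k IH] /=; rewrite IH mkseqS state_rcons. Qed.

Context (l : nat) (M : R) (cov : covers (path l)).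
Context (bound : forall k, potential (path (l + k)) <= M).

Lemma covers_path k : covers (path (l + k)).
Proof.
elim: k => [|k IH]; first by rewrite addn0.
by rewrite addnS mkseqS; exact: covers_rcons.
Qed.

Lemma lyapunov_path_le k : lyapunov (w (l + k)) <= M.
Proof.
apply: le_trans (bound k); rewrite rpdc_state lerDl; exact: total_decrement_ge0.
Qed.

Lemma decrement_path_le n : \sum_(l <= j < l + n) decrement (w j) <= M.
Proof.
apply: le_trans (bound n); apply: le_trans (_ : total_decrement (path (l + n)) <= _); last first.
  rewrite lerDr; apply: lyapunov_ge0; first exact: state_feasible.
  by apply: state_finite; exact: covers_path.
rewrite /total_decrement size_mkseq (big_cat_nat (leq0n l) (leq_addr n l)) /=.
apply: ler_wpDl; first by apply: sumr_ge0 => j _; exact: decrement_ge0.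
rewrite [leRHS]big_mkcond le_eqVlt; apply/orP; left; apply/eqP.
apply: eq_big_nat => j /andP[lj jn].
have -> : take j (path (l + n)) = path j.
  by rewrite /mkseq -map_take take_iota (minn_idPl (ltnW jn)).
have cj : covers (path j) by rewrite -(subnKC lj); exact: covers_path.
by rewrite rpdc_state cj.
Qed.

Lemma residual_series_bounded : exists C, forall n,
  \sum_(0 <= k < n) residual (w k) ^+ 2 <= C.
Proof.
pose c := primal_rate^-1 + gamma ^+ 2 * (2 / dual_rate + 2 * `|lam| / primal_rate).
have pr0 := ltW primal_rate_gt0; have dr0 := ltW dual_rate_gt0.
have c0 : 0 <= c.
  apply: addr_ge0; first by rewrite invr_ge0.
  apply: mulr_ge0; first exact: sqr_ge0.
  apply: addr_ge0; first exact: divr_ge0.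
  by apply: divr_ge0 => //; apply: mulr_ge0.
exists (\sum_(0 <= k < l) residual (w k) ^+ 2 + c * M) => n.
apply: le_trans (_ : \sum_(0 <= k < l + n) residual (w k) ^+ 2 <= _).
  rewrite [leRHS](big_cat_nat (leq0n n) (leq_addl l n)) /= lerDl.
  by apply: sumr_ge0 => j _; exact: sqr_ge0.
rewrite (big_cat_nat (leq0n l) (leq_addr n l)) /= lerD2l.
apply: le_trans (ler_wpM2l c0 (decrement_path_le n)).
rewrite mulr_sumr; apply: ler_sum => j _.
by apply: residual_le; rewrite rpdc_state; exact: state_feasible.
Qed.

Lemma path_bounded : bounded_fun (fun k => w k).
Proof.
(* Turns the bounds on squared distances into bounds on distances without square roots. *)
have sq_le (x : R) : x <= 1 + x ^+ 2 by have := sqr_ge0 (x - 1); nra.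
pose C := (1 + M / primal_rate + enorm xs) + (1 + M * (4 * gamma) + enorm ps).
have M0 : 0 <= M.
  by apply: le_trans (bound 0); apply: potential_ge0; exact: covers_path.
have g4 : 0 < 4 * gamma by rewrite mulr_gt0.
have Mp : 0 <= M / primal_rate by exact: divr_ge0 (ltW primal_rate_gt0).
have Mg : 0 <= M * (4 * gamma) by exact: mulr_ge0 (ltW g4).
have xs0 := enorm_ge0 xs; have ps0 := enorm_ge0 ps.
have C0 : 0 <= C by rewrite /C; lra.
have tail k : `|w (l + k)| <= C.
  have Uw : U (w (l + k)).1 by rewrite rpdc_state; exact: state_feasible.
  have Jw : (J (w (l + k)).1 < +oo)%E.
    by rewrite rpdc_state; apply: state_finite; exact: covers_path.
  have := le_trans (lyapunov_ge Uw Jw) (lyapunov_path_le k).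
  set z := w (l + k); rewrite -!sqr_enorm => H.
  have e1 : primal_rate * enorm (z.1 - xs) ^+ 2 <= M.
    by apply: le_trans H; rewrite lerDl; exact: divr_ge0 (sqr_ge0 _) (ltW g4).
  have e2 : enorm (z.2 - ps) ^+ 2 / (4 * gamma) <= M.
    by apply: le_trans H; rewrite lerDr; exact: mulr_ge0 (ltW primal_rate_gt0) (sqr_ge0 _).
  have {}e1 : enorm (z.1 - xs) ^+ 2 <= M / primal_rate.
    by rewrite ler_pdivlMr // mulrC.
  have {}e2 : enorm (z.2 - ps) ^+ 2 <= M * (4 * gamma).
    by rewrite -ler_pdivrMr.
  have n1 : enorm z.1 <= 1 + M / primal_rate + enorm xs.
    rewrite -{1}(subrK xs z.1); apply: le_trans (ler_enormD _ _) _; rewrite lerD2r.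
    by apply: le_trans (sq_le _) _; rewrite lerD2l.
  have n2 : enorm z.2 <= 1 + M * (4 * gamma) + enorm ps.
    rewrite -{1}(subrK ps z.2); apply: le_trans (ler_enormD _ _) _; rewrite lerD2r.
    by apply: le_trans (sq_le _) _; rewrite lerD2l.
  have z10 := enorm_ge0 z.1; have z20 := enorm_ge0 z.2.
  rewrite prod_normE ge_max; apply/andP; split.
    by apply: le_trans (normr_coord_le _) _; rewrite /C; lra.
  by apply: le_trans (normr_coord_le _) _; rewrite /C; lra.
exists (\sum_(j < l) `|w j| + C); split; first exact: num_real.
move=> x Cx k _ /=; apply: le_trans (ltW Cx).
have [kl|lk] := ltnP k l.
  rewrite (bigD1 (Ordinal kl)) //= -addrA lerDl addr_ge0 //.
  by apply: sumr_ge0 => j _; exact: normr_ge0.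
rewrite -(subnKC lk); apply: le_trans (tail _) _; rewrite lerDr.
by apply: sumr_ge0 => j _; exact: normr_ge0.
Qed.

Lemma path_summable :
  (\sum_(0 <= k <oo) (residual (w k) ^+ 2)%:E < +oo)%E.
Proof.
have [C sumC] := residual_series_bounded.
apply: (@le_lt_trans _ _ C%:E); last exact: ltry.
apply: lime_le; first by apply: is_cvg_nneseries => k _ _; rewrite lee_fin sqr_ge0.
by apply: nearW => n; rewrite sumEFin lee_fin.
Qed.

Lemma path_residual_cvg0 : (fun k => residual (w k)) @ \oo --> (0 : R).
Proof.
have [C sumC] := residual_series_bounded.
have sq0 : (fun k => residual (w k) ^+ 2) @ \oo --> (0 : R).
  apply: cvg_series_cvg_0; apply: nondecreasing_is_cvgn.
    apply/nondecreasing_seqP => n; rewrite /series /= big_nat_recr //= lerDl.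
    exact: sqr_ge0.
  by exists C => _ [n _ <-]; exact: sumC.
rewrite -(sqrtr0 R) (_ : (fun k => _) = fun k => Num.sqrt (residual (w k) ^+ 2)).
  by apply: (@cvg_comp _ _ _ _ Num.sqrt _ _ _ sq0); exact: sqrt_continuous.
by apply/funext => k; rewrite sqrtr_sqr ger0_norm // enorm_ge0.
Qed.

Lemma path_cluster_saddle (B : R) w' : elipschitz U B (grad K) ->
  cluster ((fun k => w k) @ \oo) w' -> saddle_point U L w'.
Proof.
move=> Klip; rewrite cluster_cvgE => -[Fl FF [Fw' wF]].
apply: (ref_point_cvg_saddle Klip Fw').
  by apply: wF; exists 0%N => // k _; rewrite /= rpdc_state; exact: state_feasible.
by move=> W /path_residual_cvg0 ?; exact: wF.
Qed.

End Path.

(** * Almost sure conclusions *)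

Lemma rpdc_converges (B : R) (disp : measure_display) (Omega : measurableType disp)
    (P : probability Omega R) (idx : nat -> Omega -> 'I_N) :
  elipschitz U B (grad K) -> iid_uniform P idx ->
  let w k omega := rpdc A b Ub G Jb K gamma eps rho (u0, p0) (fun j => idx j omega) k in
  [/\ {ae P, forall omega, (\sum_(0 <= k <oo) (pair_norm (w k omega -
         ref_point A b Ub G Jb K gamma eps (w k omega)) ^+ 2)%:E < +oo)%E},
      {ae P, forall omega, bounded_fun (fun k => w k omega)} &
      {ae P, forall omega, forall w',
        cluster ((fun k => w k omega) @ \oo) w' -> saddle_point U L w'}].
Proof.
move=> Klip iid w.
have good : {ae P, forall omega, exists l, exists2 M,
    covers (history idx l omega) & forall k, potential (history idx (l + k) omega) <= M}.
  have bnd := @ae_history_bounded _ _ _ P _ _ N_gt0 iid (fun s => covers s) potential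
    covers_rcons potential_ge0 potential_super.
  apply: filterS2 bnd (ae_history_covers N_gt0 iid) => omega bnd [l hl].
  have cl : covers (history idx l omega) by apply/forallP.
  by have [M hM] := bnd l cl; exists l, M.
split; apply: filterS good => omega [l [M cl hM]].
- exact: (path_summable cl hM).
- exact: (path_bounded cl hM).
- by move=> w'; exact: (path_cluster_saddle cl hM Klip).
Qed.


End RPDC.

Theorem theorem1 (R : realType) (N m : nat) (dim : 'I_N -> nat)
    (A : 'M[R]_(m, \sum_i dim i)) (b : 'cV[R]_m)
    (Ub : forall i, set 'cV[R]_(dim i))
    (G : 'cV[R]_(\sum_i dim i) -> R)
    (Jb : forall i, 'cV[R]_(dim i) -> \bar R)
    (K : 'cV[R]_(\sum_i dim i) -> R)
    (BG beta B gamma eps rho : R)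
    (u0 : 'cV[R]_(\sum_i dim i)) (p0 : 'cV[R]_m)
    (disp : measure_display) (Omega : measurableType disp)
    (P : probability Omega R) (idx : nat -> Omega -> 'I_N) :
  let U := prod_blocks Ub in
  let J := sum_blocks Jb in
  let L := lagrangian A b G Jb in
  let T := ref_point A b Ub G Jb K gamma eps in
  let w := fun (k : nat) (omega : Omega) =>
    rpdc A b Ub G Jb K gamma eps rho (u0, p0) (fun j => idx j omega) k in
  (0 < N)%N ->
  (* the feasible set *)
  closed U -> convex_set U ->
  (* J *)
  (forall i x, Jb i x != -oo%E) ->
  (forall i, convex_efunction (Ub i) (Jb i)) ->
  convex_efunction setT J -> lower_semicontinuous J ->
  (exists2 u, U u & (J u < +oo)%E) ->
  (* G *)
  convex_function setT G -> (forall u, differentiable G u) ->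
  elipschitz setT BG (grad G) ->
  (* saddle point *)
  (exists w', saddle_point U L w') ->
  (* K *)
  block_separable U K ->
  strongly_convex U beta K -> (forall u, U u -> differentiable K u) ->
  elipschitz U B (grad K) ->
  (* parameters *)
  0 < eps < beta / (BG + gamma * lambda_max (A^T *m A)) ->
  0 < rho < 2 * gamma / (2 * N%:R - 1) ->
  (* initial point and random draws *)
  U u0 ->
  iid_uniform P idx ->
  [/\ {ae P, forall omega,
        (\sum_(0 <= k <oo)
           (pair_norm (w k omega - T (w k omega)) ^+ 2)%:E < +oo)%E},
      {ae P, forall omega, bounded_fun (fun k => w k omega)} &
      {ae P, forall omega, forall w',
        cluster ((fun k => w k omega) @ \oo) w' -> saddle_point U L w'}].
Proof.
move=> U J L T w N_gt0 clU cvU JN _ Jcv Jlsc Jdom Gcv dG Glip.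
move=> [[xs ps] sad] [Kb KE] Ksc dK Klip /andP[eps_gt0 eps_lt] /andP[rho_gt0 rho_lt] Uu0 iid.
have [Uxs Jxs Axs xs_min] := saddle_pointP JN Jdom sad.
have n1 : 0 < 2 * N%:R - 1 :> R.
  by have : 1 <= N%:R :> R; [rewrite ler1n|lra].
(* Nonemptiness of the interval for [rho] forces [gamma > 0]; likewise that for [eps], with
   [beta > 0], forces [BG + gamma * lambda_max (A^T *m A)] to be positive, so both bounds can be
   cleared of denominators. *)
have gamma_gt0 : 0 < gamma.
  have := lt_trans rho_gt0 rho_lt.
  by rewrite ltr_pdivlMr // mul0r pmulr_rgt0.
have primal_gt0 : 0 < primal_rate A beta gamma eps BG.
  have bg0 : 0 < BG + gamma * lambda_max (A^T *m A).
    have := lt_trans eps_gt0 eps_lt.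
    by rewrite (pmulr_rgt0 _ Ksc.1) invr_gt0.
  move: eps_lt; rewrite ltr_pdivlMr // -ltr_pdivlMl // mulrC /primal_rate; lra.
have dual_gt0 : 0 < @dual_rate R N gamma rho.
  by move: rho_lt; rewrite ltr_pdivlMr // /dual_rate; lra.
exact: (rpdc_converges clU cvU JN Jcv Jlsc Jdom KE Ksc dK eps_gt0 gamma_gt0 rho_gt0
  N_gt0 Gcv dG Glip primal_gt0 dual_gt0 Uxs Jxs Axs xs_min p0 Uu0 Klip iid).
Qed.
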